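(* Let $(M,\eta)$ be a $(2n+1)$-dimensional contact manifold and let $\iota:N\hookrightarrow M$ be a coisotropic submanifold without horizontal points such that the quotient $\tilde N=N/TN^{\perp_\Lambda}$ (the space of leaves of the foliation of $N$ defined by $TN^{\perp_\Lambda}$) is a manifold. Let $\pi:N\to\tilde N$ be the projection and let $\tilde\eta$ be the unique contact form on $\tilde N$ with $\pi^*\tilde\eta=\iota^*\eta$. Let $L\subseteq M$ be a Legendrian submanifold such that $N$ and $L$ have clean intersection, that is, $N\cap L$ is a submanifold and $T(N\cap L)=TN\cap TL$. Then $\tilde L=\pi(L\cap N)\subseteq\tilde N$ is a Legendrian submanifold of $(\tilde N,\tilde\eta)$.
   Context: A contact manifold $(M,\eta)$ is a $(2n+1)$-dimensional manifold $M$ with a $1$-form $\eta$ such that $\eta\wedge(d\eta)^n$ is nowhere zero. The Reeb vector field $\mathcal{R}$ is the unique vector field with $\iota_{\mathcal{R}}\eta=1$, $\iota_{\mathcal{R}}d\eta=0$. The map $\flat:TM\to T^*M$, $\flat(v)=\iota_v d\eta+\eta(v)\eta$, is a vector bundle isomorphism with inverse $\sharp$; set $\Lambda(\alpha,\beta)=-d\eta(\sharp\alpha,\sharp\beta)$ and $\sharp_\Lambda(\alpha)=\Lambda(\alpha,\cdot)=\sharp\alpha-\alpha(\mathcal{R})\mathcal{R}$. For a linear subspace $\Delta_x\subseteq T_xM$, with annihilator $\Delta_x^\circ\subseteq T_x^*M$, the contact complement is $\Delta_x^{\perp_\Lambda}=\sharp_\Lambda(\Delta_x^\circ)$; for distributions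 it is taken pointwise. A submanifold $N\subseteq M$ is coisotropic if $TN^{\perp_\Lambda}\subseteq TN$ and Legendrian if $TN^{\perp_\Lambda}=TN$. A point $x\in N$ is horizontal if $T_xN\subseteq\ker\eta_x$. ''The quotient is a manifold'' means that $\tilde N$ has a smooth manifold structure for which $\pi$ is a submersion. The existence and uniqueness of the contact form $\tilde\eta$ on $\tilde N$ with $\pi^*\tilde\eta=\iota^*\eta$ is part of the setting.
   Formalization: The image of L∩N may cross itself, so it need not be a submanifold; the formal conclusion says that it is the image of a Legendrian immersion and that, whenever it is an embedded submanifold, it is Legendrian. *)

(* Defs.v *)
From HB Require Import structures.
From mathcomp Require Import all_boot all_order all_algebra perm.
From mathcomp Require Import boolp classical_sets functions reals.
From mathcomp Require Import topology normedtype derive.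
Set Implicit Arguments.
Unset Strict Implicit.
Unset Printing Implicit Defensive.
Import Order.TTheory GRing.Theory Num.Theory.
Import numFieldNormedType.Exports.
Local Open Scope classical_set_scope.
Local Open Scope ring_scope.

(* C^k regularity on an open set A, by iterated directional derivatives. *)
Fixpoint Ck_on (R : realType) (m p : nat) (k : nat) (A : set 'rV[R]_m)
    (f : 'rV[R]_m -> 'rV[R]_p) : Prop :=
  match k with
  | 0%N => forall x, A x -> {for x, continuous f}
  | k'.+1 => (forall x, A x -> differentiable f x) /\
             (forall v, Ck_on k' A (fun x => 'D_v f x))
  end.

Definition smooth_on (R : realType) (m p : nat) (A : set 'rV[R]_m)
    (f : 'rV[R]_m -> 'rV[R]_p) : Prop :=
  forall k, Ck_on k A f.

(* A Hausdorff, second countable smooth manifold of dimension m.  The atlas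
   is indexed by the points: [chart x] is a chart whose domain [dom x]
   contains x, with inverse [chart_inv x] (junk outside the image). *)
Record manifold (R : realType) (m : nat) := Manifold {
  carrier :> topologicalType;
  dom : carrier -> set carrier;
  chart : carrier -> carrier -> 'rV[R]_m;
  chart_inv : carrier -> 'rV[R]_m -> carrier;
  manifold_hausdorff : hausdorff_space carrier;
  manifold_countable : @second_countable carrier;
  dom_open : forall x, open (dom x);
  dom_self : forall x, dom x x;
  codom_open : forall x, open (chart x @` dom x);
  chartK : forall x y, dom x y -> chart_inv x (chart x y) = y;
  chart_continuous : forall x y, dom x y -> {for y, continuous (chart x)};
  chart_inv_continuous : forall x u,
    (chart x @` dom x) u -> {for u, continuous (chart_inv x)};
  chart_smooth : forall x y,
    smooth_on (chart x @` (dom x `&` dom y)) (chart y \o chart_inv x)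
}.

Arguments dom {R m} _ _ _.
Arguments chart {R m} _ _ _.
Arguments chart_inv {R m} _ _ _.

(* The tangent space at x is represented by 'rV[R]_m through the distinguished
   chart [chart M x]; likewise T*_xM is 'rV[R]_m with the dual coordinates. *)

Section Maps.
Variables (R : realType) (m p : nat) (M : manifold R m) (N : manifold R p).

Definition in_charts (f : M -> N) (x : M) : 'rV[R]_m -> 'rV[R]_p :=
  chart N (f x) \o f \o chart_inv M x.

Definition smooth_map (f : M -> N) : Prop :=
  continuous f /\
  forall x, smooth_on (chart M x @` (dom M x `&` f @^-1` dom N (f x)))
                      (in_charts f x).

Definition mdiff (f : M -> N) (x : M) : 'rV[R]_m -> 'rV[R]_p :=
  'd (in_charts f x) (chart M x x).

Definition immersion (f : M -> N) : Prop :=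
  smooth_map f /\ forall x, injective (mdiff f x).

Definition submersion (f : M -> N) : Prop :=
  smooth_map f /\ forall x, range (mdiff f x) = setT.

Definition embedding (f : M -> N) : Prop :=
  [/\ immersion f, injective f &
      forall U : set M, open U -> exists2 V : set N, open V & U = f @^-1` V].

End Maps.

Record submanifold (R : realType) (m : nat) (M : manifold R m) (p : nat) :=
  Submanifold {
    submanifold_carrier :> manifold R p;
    incl_map : submanifold_carrier -> M;
    incl_map_embedding : embedding incl_map
  }.

Arguments incl_map {R m M p} _ _.

Definition tangent (R : realType) (m p : nat) (M : manifold R m)
    (N : manifold R p) (f : N -> M) (x : N) : set 'rV[R]_m :=
  range (mdiff f x).

Definition clean_intersection (R : realType) (m p q : nat) (M : manifold R m)
    (N : submanifold M p) (L : submanifold M q) : Prop :=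
  exists r (I : submanifold M r),
    range (incl_map I) = range (incl_map N) `&` range (incl_map L) /\
    forall (z : I) (x : N) (y : L),
       incl_map N x = incl_map I z -> incl_map L y = incl_map I z ->
       tangent (incl_map I) z =
       tangent (incl_map N) x `&` tangent (incl_map L) y.

Definition pairing (R : realType) (m : nat) (a v : 'rV[R]_m) : R :=
  (a *m v^T) 0 0.

Definition oneform (R : realType) (m : nat) (M : manifold R m) : Type :=
  M -> 'rV[R]_m.

Section Forms.
Variables (R : realType) (m : nat) (M : manifold R m) (eta : oneform M).

(* Coefficients of eta in the chart at x: the pullback of eta under
   [chart_inv M x].  'J is the matrix acting on row vectors from the right. *)
Definition form_in_chart (x : M) (u : 'rV[R]_m) : 'rV[R]_m :=
  let z := chart_inv M x u in
  eta z *m ('J (chart M z \o chart_inv M x) u)^T.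

Definition smooth_form : Prop :=
  forall x, smooth_on (chart M x @` dom M x) (form_in_chart x).

(* d eta (e_i, e_j) = d_i eta_j - d_j eta_i. *)
Definition dform (x : M) : 'M[R]_m :=
  \matrix_(i, j)
    (('D_(delta_mx 0 i) (form_in_chart x) (chart M x x)) 0 j
     - ('D_(delta_mx 0 j) (form_in_chart x) (chart M x x)) 0 i).

Definition dform2 (x : M) (u v : 'rV[R]_m) : R := pairing (u *m dform x) v.

(* v |-> i_v (d eta) + eta(v) eta, as a matrix acting on row vectors. *)
Definition flat_mx (x : M) : 'M[R]_m := dform x + (eta x)^T *m eta x.

Definition sharp (x : M) (a : 'rV[R]_m) : 'rV[R]_m := a *m invmx (flat_mx x).

Definition Lambda (x : M) (a b : 'rV[R]_m) : R :=
  - dform2 x (sharp x a) (sharp x b).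

(* Lambda(a, -), a functional on covectors, read as a tangent vector. *)
Definition sharp_Lambda (x : M) (a : 'rV[R]_m) : 'rV[R]_m :=
  \row_i Lambda x a (delta_mx 0 i).

Definition annihilator (D : set 'rV[R]_m) : set 'rV[R]_m :=
  [set a | forall v, D v -> pairing a v = 0].

Definition contact_complement (x : M) (D : set 'rV[R]_m) : set 'rV[R]_m :=
  sharp_Lambda x @` annihilator D.

Definition coisotropic (p : nat) (N : manifold R p) (f : N -> M) : Prop :=
  forall x, contact_complement (f x) (tangent f x) `<=` tangent f x.

Definition legendrian (p : nat) (N : manifold R p) (f : N -> M) : Prop :=
  forall x, contact_complement (f x) (tangent f x) = tangent f x.

Definition horizontal (p : nat) (N : manifold R p) (f : N -> M) (x : N) : Prop :=
  tangent f x `<=` [set v | pairing (eta (f x)) v = 0].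

(* For f an immersion, the distribution TN^perp `&` TN read in TN. *)
Definition characteristic (p : nat) (N : manifold R p) (f : N -> M) (x : N) :
    set 'rV[R]_p :=
  mdiff f x @^-1` contact_complement (f x) (tangent f x).

End Forms.

(* The value of eta /\ (d eta)^n on (v_0, ..., v_2n). *)
Definition contact_volume (R : realType) (n : nat) (M : manifold R n.*2.+1)
    (eta : oneform M) (x : M) (v : 'I_n.*2.+1 -> 'rV[R]_n.*2.+1) : R :=
  (2 ^+ n)^-1 * \sum_(s : 'S_n.*2.+1) (-1) ^+ s *
    (pairing (eta x) (v (s ord0)) *
     \prod_(i < n) dform2 eta x (v (s (inord i.*2.+1))) (v (s (inord i.*2.+2)))).

Definition contact_form (R : realType) (n : nat) (M : manifold R n.*2.+1)
    (eta : oneform M) : Prop :=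
  smooth_form eta /\ forall x, exists v, contact_volume eta x v != 0.

(* The leaf through x is the union of the connected integral manifolds of D
   containing x. *)
Definition same_leaf (R : realType) (m : nat) (N : manifold R m)
    (D : N -> set 'rV[R]_m) (x y : N) : Prop :=
  exists r (P : manifold R r) (j : P -> N),
    [/\ immersion j, injective j, connected [set: P],
        forall p, tangent j p = D (j p) &
        range j x /\ range j y].

Definition leaf_space (R : realType) (m k : nat) (N : manifold R m)
    (D : N -> set 'rV[R]_m) (Q : manifold R k) (proj : N -> Q) : Prop :=
  [/\ submersion proj, range proj = setT &
      forall x y, proj x = proj y <-> same_leaf D x y].

(* The image of a clean intersection under a quotient map may cross itself, so
   a subset S counts as a Legendrian submanifold when it is the image of a
   Legendrian immersion and, in case S is embedded, is Legendrian as such. *)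
Definition legendrian_submanifold (R : realType) (m : nat) (M : manifold R m)
    (eta : oneform M) (S : set M) : Prop :=
  (exists q (Q : manifold R q) (f : Q -> M),
     [/\ immersion f, range f = S & legendrian eta f]) /\
  (forall q (Q : submanifold M q),
     range (incl_map Q) = S -> legendrian eta (incl_map Q)).

(* Main.v *)
Require Import Defs.
From HB Require Import structures.
From mathcomp Require Import all_boot all_order all_algebra perm.
From mathcomp Require Import boolp classical_sets functions cardinality reals.
From mathcomp Require Import topology normedtype landau derive sequences trigo.
From mathcomp Require Import interval_inference ring lra zify.
Set Implicit Arguments.
Unset Strict Implicit.
Unset Printing Implicit Defensive.
Import Order.TTheory GRing.Theory Num.Theory.
Import numFieldNormedType.Exports.
Local Open Scope classical_set_scope.
Local Open Scope ring_scope.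

(* Since the quotient carries etat with pi^*etat = iota^*eta, and leaves are
   tangent to D = TN^perp, i_v d eta vanishes on TN for v in D.  As N has no
   horizontal points this forces the Reeb field to be tangent to N, and then D
   is the kernel of iota^*eta and iota^*d eta: the linear problem is symplectic
   reduction inside ker eta, where pi_*(TN /\ TL) is its own complement because
   the annihilator of TN /\ TL is the sum of the annihilators.  In particular
   g = pi restricted to N /\ L has constant rank k.

   By the constant rank theorem the image of g is the image of an immersion of
   countably many copies of R^k, with the same tangent spaces as g; this gives
   the Legendrian immersion.  If that image is also an embedded submanifold Q,
   the immersion lifts to a surjective immersion onto Q; by Baire's theorem it
   cannot raise the dimension, so Q has the same tangent spaces. *)

(** * Smooth maps between coordinate spaces *)

(** The Reeb step rests on one formula. For [a] in the annihilator of TN, v = sharp_Lambda(a) lies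
    in TN^perp, hence in TN, and i_v d eta = a - a(R) eta. On TN this reduces to -a(R) eta; it must
    vanish there since v projects to 0, and eta is nonzero on TN, so a(R) = 0. The relation between
    d etat and d eta is not assumed: it is derived from that between etat and eta. As the exterior
    derivative is defined by coordinates, this takes symmetry of second derivatives and the passage
    between charts. The rank of g is k because a Legendrian subspace of a contact space of dimension
    2k+1 has dimension k. The obstacle is that pi(N /\ L) has no manifold structure of its own:
    distinct sheets of N /\ L may be projected onto crossing pieces. The source of the immersion is
    therefore a disjoint union of slices transverse to the kernel of dg; second countability makes
    countably many suffice. For an embedded image Q, comparing tangent spaces only gives k <= dim Q.
    The reverse inequality needs a global argument, since a union of immersed pieces could fill a
    larger Q if there were uncountably many of them. *)

Lemma near_forall (T : topologicalType) (x : T) (I : finType) (P : I -> set T) :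
  (forall i, \forall y \near x, P i y) -> \forall y \near x, forall i, P i y.
Proof. exact: filter_forall. Qed.

Lemma near_dist_lt (R : realType) (V : normedModType R) (x : V) (e : R) :
  0 < e -> \forall y \near x, `|x - y| < e.
Proof. by move=> e0; apply/nbhs_normP; exists e. Qed.

Lemma continuous_at_normP (R : realType) (V W : normedModType R) (f : V -> W) x :
  {for x, continuous f} <->
  forall e, 0 < e -> \forall y \near x, `|f x - f y| < e.
Proof. exact: cvgrPdist_lt. Qed.

Lemma norm_rV_le (R : realType) (n : nat) (v : 'rV[R]_n) (e : R) :
  0 <= e -> (`|v| <= e) <-> (forall i, `|v 0 i| <= e).
Proof.
move=> e0; rewrite /Num.Def.normr /= mx_normrE; split=> [h i|h].
  apply: le_trans h.
  exact: (le_bigmax _ (fun ij : 'I_1 * 'I_n => `|v ij.1 ij.2|) (0, i)).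
by apply: bigmax_le => // ij _ /=; rewrite (ord1 ij.1); exact: h.
Qed.

Lemma norm_coord_le (R : realType) (n : nat) (v : 'rV[R]_n) i :
  `|v 0 i| <= `|v|.
Proof. by have /(norm_rV_le v (normr_ge0 v)) := lexx `|v|; apply. Qed.

Lemma mulmx_bound (R : realType) (m n : nat) (A : 'M[R]_(m, n)) :
  exists2 C : R, 0 < C & forall v : 'rV[R]_m, `|v *m A| <= C * `|v|.
Proof.
exists (1 + \sum_i \sum_j `|A i j|).
  by rewrite ltr_wpDr// sumr_ge0// => i _; rewrite sumr_ge0.
move=> v; have C0 : 0 <= \sum_i \sum_j `|A i j|.
  by rewrite sumr_ge0// => i _; rewrite sumr_ge0.
apply/norm_rV_le => [|j]; first by rewrite mulr_ge0// addr_ge0.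
rewrite mxE (le_trans (ler_norm_sum _ _ _))// mulrDl mul1r ler_wpDl//.
rewrite mulr_suml ler_sum// => i _; rewrite normrM mulrC ler_pM ?norm_coord_le//.
by rewrite (bigD1 j)//= lerDl sumr_ge0.
Qed.

Lemma mulmx_continuous (R : realType) (m n : nat) (A : 'M[R]_(m, n)) :
  continuous (fun v : 'rV[R]_m => v *m A).
Proof.
have [C C0 hC] := mulmx_bound A => v; apply/continuous_at_normP => e e0.
have := @near_dist_lt _ _ v (C^-1 * e); rewrite mulr_gt0 ?invr_gt0// => /(_ isT).
by apply: filterS => w vw; rewrite -mulmxBl (le_lt_trans (hC _))// -ltr_pdivlMl.
Qed.

Lemma differentiable_mulmx (R : realType) (m n : nat) (A : 'M[R]_(m, n)) v :
  differentiable (fun w : 'rV[R]_m => w *m A) v.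
Proof.
exact: (@linear_differentiable _ _ _ (mulmxr A) v (@mulmx_continuous _ _ _ A)).
Qed.

Lemma diff_mulmx (R : realType) (m n : nat) (A : 'M[R]_(m, n)) v w :
  'd (fun w : 'rV[R]_m => w *m A) v w = w *m A.
Proof. by rewrite (@diff_lin _ _ _ (mulmxr A) v (@mulmx_continuous _ _ _ A)). Qed.

Lemma diffJ (R : realType) (m n : nat) (f : 'rV[R]_m -> 'rV[R]_n) x v :
  'd f x v = v *m 'J f x.
Proof. by rewrite mul_rV_lin1. Qed.

Lemma differentiable_linear_approx (R : realType) (V : normedModType R) (m : nat)
    (f : 'rV[R]_m -> V) (L : {linear 'rV[R]_m -> V}) x :
  continuous L ->
  (forall e, 0 < e -> \forall h \near (0 : 'rV[R]_m),
     `|f (h + x) - f x - L h| <= e * `|h|) ->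
  differentiable f x /\ 'd f x = L :> (_ -> _).
Proof.
move=> cL hL.
have fE : f \o shift x = cst (f x) + L +o_ (0 : 'rV[R]_m) id.
  apply/eqaddoP => e e0; near=> h => /=.
  rewrite /= [X in `|X|](_ : _ = f (h + x) - f x - L h); last first.
    by rewrite -addrA -opprD.
  by near: h; exact: hL.
have dE := diff_unique cL fE; split=> //; apply/diff_locallyP.
by rewrite dE; split.
Unshelve. all: by end_near. Qed.

Lemma near_eq_differentiable (R : realType) (V : normedModType R) (m : nat)
    (f g : 'rV[R]_m -> V) x :
  (\forall y \near x, f y = g y) -> differentiable f x ->
  differentiable g x /\ 'd g x = 'd f x :> (_ -> _).
Proof.
move=> fg df; apply: differentiable_linear_approx.
  exact: diff_continuous.
move=> e e0; have /diff_locallyP[_ /eqaddoP/(_ e e0)] := df.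
have fg0 : \forall h \near (0 : 'rV[R]_m), f (h + x) = g (h + x).
  by rewrite (near_shift x) /=; apply: filterS fg => y; rewrite sub0r /= subrK.
apply: filterS2 fg0 => h /= <-; rewrite -(nbhs_singleton fg).
by rewrite [X in `|X| <= _](_ : _ = f (h + x) - f x - 'd f x h)// -addrA -opprD.
Qed.

Lemma differentiable_littleo (R : realType) (V : normedModType R) (m : nat)
    (f : 'rV[R]_m -> V) x : differentiable f x ->
  forall e, 0 < e -> \forall h \near (0 : 'rV[R]_m),
     `|f (h + x) - f x - 'd f x h| <= e * `|h|.
Proof.
move=> df e e0; have /diff_locallyP[_ /eqaddoP/(_ e e0)] := df.
apply: filterS => h /=.
by rewrite [X in `|X| <= _](_ : _ = f (h + x) - f x - 'd f x h)// -addrA -opprD.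
Qed.

Lemma differentiable_mxP (R : realType) (m p q : nat) (f : 'rV[R]_m -> 'M[R]_(p, q)) x :
  differentiable f x <-> forall i j, differentiable (fun y => f y i j) x.
Proof.
split=> [df i j|df].
  apply: (@differentiable_comp _ _ _ _ f (fun M => M i j)) => //.
  exact: differentiable_coord.
have -> : f = \sum_i \sum_j (fun y => f y i j *: delta_mx i j).
  apply/funext => y; rewrite [LHS]matrix_sum_delta fct_sumE.
  by apply: eq_bigr => i _; rewrite fct_sumE.
apply: differentiable_sum => i; apply: differentiable_sum => j.
exact: differentiableZl.
Qed.

(* The predicate Ck_on of the definitions, for an arbitrary codomain. *)
Fixpoint Cn (R : realType) (V W : normedModType R) (k : nat) (A : set V)
    (f : V -> W) : Prop :=
  match k with
  | 0%N => forall x, A x -> {for x, continuous f}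
  | k'.+1 => (forall x, A x -> differentiable f x) /\
             (forall v, Cn k' A (fun x => 'D_v f x))
  end.

Section Cn.
Variables (R : realType) (m : nat).
Implicit Types (A B : set 'rV[R]_m) (W : normedModType R).

Lemma Ck_onE p k A (f : 'rV[R]_m -> 'rV[R]_p) : Ck_on k A f <-> Cn k A f.
Proof.
elim: k f => [|k IHk] f //=; split=> -[df Df]; split=> // v; exact/IHk.
Qed.

Lemma Cn_sub W k A B (f : 'rV[R]_m -> W) : A `<=` B -> Cn k B f -> Cn k A f.
Proof.
move=> AB; elim: k f => [|k IHk] f /=; first by move=> + x Ax; apply; exact: AB.
by move=> [df Df]; split=> [x Ax|v]; [exact/df/AB|exact/IHk/Df].
Qed.

Lemma CnS W k A (f : 'rV[R]_m -> W) : Cn k.+1 A f -> Cn k A f.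
Proof.
elim: k f => [|k IHk] f; first by move=> [df _] x /df /differentiable_continuous.
by move=> [df Df]; split=> // v; apply: IHk.
Qed.

Lemma open_near_eq W A (f g : 'rV[R]_m -> W) x : open A -> A x ->
  (forall x, A x -> f x = g x) -> \forall y \near x, f y = g y.
Proof.
move=> oA Ax fg; have : nbhs x A by apply: open_nbhs_nbhs; split.
exact: filterS.
Qed.

Lemma Cn_ext W k A (f g : 'rV[R]_m -> W) : open A ->
  (forall x, A x -> f x = g x) -> Cn k A f -> Cn k A g.
Proof.
move=> oA; elim: k f g => [|k IHk] f g fg.
  move=> cf x Ax; apply/continuous_at_normP => e e0.
  have /continuous_at_normP/(_ e e0) := cf x Ax.
  by apply: filterS2 (open_near_eq oA Ax fg) => y <-; rewrite fg.
move=> [df Df]; split=> [x Ax|v].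
  by have [] := near_eq_differentiable (open_near_eq oA Ax fg) (df x Ax).
apply: IHk (Df v) => x Ax; apply: near_eq_derive.
exact: open_near_eq oA Ax fg.
Qed.

Lemma Cn_cst W k A (c : W) : Cn k A (fun _ : 'rV[R]_m => c).
Proof.
elim: k c => [|k IHk] c /=; first by move=> x _; exact: cst_continuous.
split=> [x _|v]; first exact: differentiable_cst.
have -> : (fun x : 'rV[R]_m => 'D_v (fun=> c) x) = fun=> 0; last exact: IHk.
by apply/funext => x; exact: derive_cst.
Qed.

Lemma Cn_add W k A (f g : 'rV[R]_m -> W) : open A ->
  Cn k A f -> Cn k A g -> Cn k A (fun x => f x + g x).
Proof.
move=> oA; elim: k f g => [|k IHk] f g.
  by move=> cf cg x Ax; apply: continuousD; [exact: cf|exact: cg].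
move=> [df Df] [dg Dg]; split=> [x Ax|v].
  by apply: differentiableD; [exact: df|exact: dg].
apply: Cn_ext (IHk _ _ (Df v) (Dg v)) => // x Ax.
by rewrite -deriveD//; apply: diff_derivable; [exact: df|exact: dg].
Qed.

Lemma Cn_sum W k A (I : finType) (f : I -> 'rV[R]_m -> W) : open A ->
  (forall i, Cn k A (f i)) -> Cn k A (fun x => \sum_i f i x).
Proof.
move=> oA hf; rewrite -[X in Cn k A X]/(fun x => _).
elim: (index_enum I) => [|i s IHs].
  by apply: Cn_ext (Cn_cst k A (0 : W)) => // x _; rewrite big_nil.
by apply: Cn_ext (Cn_add oA (hf i) IHs) => // x _; rewrite big_cons.
Qed.

Lemma Cn_mul k A (f g : 'rV[R]_m -> R) : open A ->
  Cn k A f -> Cn k A g -> Cn k A (fun x => f x * g x).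
Proof.
move=> oA; elim: k f g => [|k IHk] f g.
  by move=> cf cg x Ax; apply: continuousM; [exact: cf|exact: cg].
move=> Cf Cg; have [[df Df] [dg Dg]] := (Cf, Cg); split=> [x Ax|v].
  by apply: differentiableM; [exact: df|exact: dg].
apply: Cn_ext (Cn_add oA (IHk _ _ (CnS Cf) (Dg v)) (IHk _ _ (CnS Cg) (Df v)))=> // x Ax.
by rewrite (deriveM (diff_derivable (df x Ax)) (diff_derivable (dg x Ax))).
Qed.

Lemma Cn_prod k A (I : finType) (f : I -> 'rV[R]_m -> R) : open A ->
  (forall i, Cn k A (f i)) -> Cn k A (fun x => \prod_i f i x).
Proof.
move=> oA hf; rewrite -[X in Cn k A X]/(fun x => _).
elim: (index_enum I) => [|i s IHs].
  by apply: Cn_ext (@Cn_cst R k A 1) => // x _; rewrite big_nil.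
by apply: Cn_ext (Cn_mul oA (hf i) IHs) => // x _; rewrite big_cons.
Qed.

(** The derivative is -f^-2 D_v f, which involves the inverse itself only to order [k], so the
    induction closes. *)
Lemma Cn_inv k A (f : 'rV[R]_m -> R) : open A -> (forall x, A x -> f x != 0) ->
  Cn k A f -> Cn k A (fun x => (f x)^-1).
Proof.
move=> oA f0; elim: k => [|k IHk] Cf.
  by move=> x Ax; apply: continuousV; [exact: f0|exact: Cf].
have [df Df] := Cf; split=> [x Ax|v].
  by apply: differentiableV; [exact: df|exact: f0].
have Ci := IHk (CnS Cf).
apply: Cn_ext (Cn_mul oA (@Cn_cst R k A (-1)) (Cn_mul oA (Cn_mul oA Ci Ci) (Df v))) => // x Ax.
rewrite deriveV ?f0//; last exact/diff_derivable/df.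
by rewrite mulN1r /GRing.scale /= mulNr expr2 invfM.
Qed.

Lemma Cn_mxP p q k A (f : 'rV[R]_m -> 'M[R]_(p, q)) : open A ->
  Cn k A f <-> forall i j, Cn k A (fun x => f x i j).
Proof.
move=> oA; elim: k f => [|k IHk] f.
  split=> [cf i j x Ax|cf x Ax].
    by apply: (@continuous_comp _ _ _ f (fun M => M i j)); [exact: cf|exact: coord_continuous].
  move=> B [P fP PB]; have : \forall y \near x, forall i j, P i j (f y i j).
    apply: (@near_forall _ x _ (fun i y => forall j, P i j (f y i j))) => i.
    apply: (@near_forall _ x _ (fun j y => P i j (f y i j))) => j.
    exact: (cf i j x Ax).
  by apply: filterS => y hy; exact: PB.
split=> [[df Df] i j|Cf].
  split=> [x Ax|v]; first exact: ((differentiable_mxP f x).1 (df x Ax) i j).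
  apply: Cn_ext (proj1 (IHk _) (Df v) i j) => // x Ax.
  by rewrite derive_mx ?mxE//; exact/diff_derivable/df.
have df x : A x -> differentiable f x.
  by move=> Ax; apply/differentiable_mxP => i j; exact: (Cf i j).1.
split=> // v; apply/IHk => i j; apply: Cn_ext ((Cf i j).2 v) => // x Ax.
by rewrite derive_mx ?mxE//; exact/diff_derivable/df.
Qed.

Lemma Cn_mulmx p q s k A (f : 'rV[R]_m -> 'M[R]_(p, q)) (g : 'rV[R]_m -> 'M[R]_(q, s)) :
  open A -> Cn k A f -> Cn k A g -> Cn k A (fun x => f x *m g x).
Proof.
move=> oA /Cn_mxP Cf /Cn_mxP Cg; apply/Cn_mxP => // i j.
have := @Cn_sum _ k A _ (fun l x => f x i l * g x l j) oA
  (fun l => Cn_mul oA (Cf oA i l) (Cg oA l j)).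
by apply: Cn_ext => // x _; rewrite mxE.
Qed.

Lemma Cn_mul_cst p q k A (M : 'M[R]_(p, q)) (f : 'rV[R]_m -> 'rV[R]_p) : open A ->
  Cn k A f -> Cn k A (fun x => f x *m M).
Proof. by move=> oA Cf; apply: Cn_mulmx => //; exact: Cn_cst. Qed.

Lemma Cn_det n k A (f : 'rV[R]_m -> 'M[R]_n) : open A ->
  Cn k A f -> Cn k A (fun x => \det (f x)).
Proof.
move=> oA /Cn_mxP Cf; apply: Cn_sum => // s; apply: Cn_mul => //; first exact: Cn_cst.
by apply: Cn_prod => // i; exact: Cf.
Qed.

Lemma Cn_invmx n k A (f : 'rV[R]_m -> 'M[R]_n) : open A ->
  (forall x, A x -> f x \in unitmx) -> Cn k A f -> Cn k A (fun x => invmx (f x)).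
Proof.
move=> oA fU Cf; apply/Cn_mxP => // i j.
have CI : Cn k A (fun x => (\det (f x))^-1).
  by apply: Cn_inv => //; [move=> x Ax; rewrite -unitfE; exact: fU|exact: Cn_det].
have CC : Cn k A (fun x => cofactor (f x) j i).
  apply: Cn_mul => //; first exact: Cn_cst.
  apply: Cn_det => //; apply/Cn_mxP => // a b.
  apply: Cn_ext ((Cn_mxP k f oA).1 Cf (lift j a) (lift i b)) => // x _.
  by rewrite !mxE.
apply: Cn_ext (Cn_mul oA CI CC) => // x Ax.
by rewrite /invmx fU// !mxE.
Qed.

Lemma Cn_id k A : open A -> Cn k A (@id 'rV[R]_m).
Proof.
move=> oA; case: k => [|k]; first by move=> x _ B.
split=> [x _|v]; first by apply: ex_diff.
by apply: Cn_ext (Cn_cst k A v) => // x _; rewrite derive_id.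
Qed.

Lemma derive_rV W (f : 'rV[R]_m -> W) x v : differentiable f x ->
  'D_v f x = \sum_j v 0 j *: 'D_(delta_mx 0 j) f x.
Proof.
move=> df; rewrite deriveE// {1}(row_sum_delta v) linear_sum.
by apply: eq_bigr => j _; rewrite linearZ /= deriveE.
Qed.

End Cn.

Lemma derive_comp_rV (R : realType) (m p : nat) (W : normedModType R)
    (f : 'rV[R]_m -> 'rV[R]_p) (g : 'rV[R]_p -> W) x v :
  differentiable f x -> differentiable g (f x) ->
  'D_v (g \o f) x = 'D_('D_v f x) g (f x).
Proof.
move=> df dg; rewrite !deriveE//; last exact: differentiable_comp.
by rewrite diff_comp.
Qed.

(** The chain rule is expanded over basis directions, D_v (g o f) = sum_l (D_v f)_l (D_l g) o f: the
    direction in which [g] is differentiated no longer depends on the point, and the induction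
    hypothesis applies to each D_l g. *)
Lemma Cn_comp (R : realType) (m p q r : nat) k (A : set 'rV[R]_m) (B : set 'rV[R]_p)
    (f : 'rV[R]_m -> 'rV[R]_p) (g : 'rV[R]_p -> 'M[R]_(q, r)) :
  open A -> (forall x, A x -> B (f x)) -> Cn k A f -> Cn k B g -> Cn k A (g \o f).
Proof.
move=> oA AB; elim: k g => [|k IHk] g Cf Cg.
  by move=> x Ax; apply: continuous_comp; [exact: Cf|exact/Cg/AB].
have [[df Df] [dg Dg]] := (Cf, Cg); split=> [x Ax|v].
  by apply: differentiable_comp; [exact: df|exact/dg/AB].
apply/Cn_mxP => // i j.
have := @Cn_sum R m _ k A _ (fun l x => ('D_v f x) 0 l *
  ('D_(delta_mx 0 l) g (f x)) i j) oA _.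
move=> H; apply: Cn_ext (H _) => // [x Ax|l].
  rewrite (derive_comp_rV v (df x Ax) (dg _ (AB x Ax))).
  rewrite (derive_rV _ (dg _ (AB _ Ax))) summxE; apply: eq_bigr => l _.
  by rewrite !mxE.
apply: Cn_mul => //; first exact: ((Cn_mxP k _ oA).1 (Df v) 0 l).
by have /(Cn_mxP k _ oA) := IHk _ (CnS Cf) (Dg (delta_mx 0 l)); exact.
Qed.

(** One neighbourhood serves all orders at once, so the notion passes to derivatives and to nearby
    points without shrinking. *)
Definition smooth_at (R : realType) (m : nat) (W : normedModType R)
    (f : 'rV[R]_m -> W) (x : 'rV[R]_m) : Prop :=
  exists A, [/\ open A, A x & forall k, Cn k A f].

Section SmoothAt.
Variables (R : realType) (m : nat).
Implicit Types (W : normedModType R) (x : 'rV[R]_m).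

Lemma smooth_at_near W (f : 'rV[R]_m -> W) x :
  smooth_at f x -> \forall y \near x, smooth_at f y.
Proof.
move=> [A [oA Ax CA]]; have : nbhs x A by apply: open_nbhs_nbhs; split.
by apply: filterS => y Ay; exists A.
Qed.

Lemma smooth_at_ext W (f g : 'rV[R]_m -> W) x :
  (\forall y \near x, f y = g y) -> smooth_at f x -> smooth_at g x.
Proof.
move=> fg [A [oA Ax CA]]; exists (A `&` interior [set y | f y = g y]); split.
- by apply: openI => //; exact: open_interior.
- by split.
- move=> k; apply: (@Cn_ext _ _ _ _ _ f).
  + by apply: openI => //; exact: open_interior.
  + by move=> y [_ /interior_subset].
  + by apply: Cn_sub (CA k) => y [].
Qed.

Lemma smooth_at_diff W (f : 'rV[R]_m -> W) x : smooth_at f x -> differentiable f x.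
Proof. by move=> [A [oA Ax /(_ 1)[+ _]]]; apply. Qed.

Lemma smooth_at_cont W (f : 'rV[R]_m -> W) x : smooth_at f x -> {for x, continuous f}.
Proof. by move/smooth_at_diff/differentiable_continuous. Qed.

Lemma smooth_at_derive W (f : 'rV[R]_m -> W) x v : smooth_at f x ->
  smooth_at ('D_v f) x.
Proof.
by move=> [A [oA Ax CA]]; exists A; split=> // k; exact: (CA k.+1).2.
Qed.

Lemma smooth_at_comp p q r (f : 'rV[R]_m -> 'rV[R]_p) (g : 'rV[R]_p -> 'M[R]_(q, r)) x :
  smooth_at f x -> smooth_at g (f x) -> smooth_at (g \o f) x.
Proof.
move=> [A [oA Ax CA]] [B [oB Bx CB]]; exists (A `&` f @^-1` B).
have oAB : open (A `&` f @^-1` B).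
  rewrite openE => y [Ay By]; apply: filterI.
    by apply: open_nbhs_nbhs; split.
  by apply: (CA 0 y Ay); apply: open_nbhs_nbhs; split.
split=> // k; apply: Cn_comp (CB k) => //; first by move=> y [].
by apply: Cn_sub (CA k) => y [].
Qed.

Lemma smooth_at_mul_cst p q (M : 'M[R]_(p, q)) (f : 'rV[R]_m -> 'rV[R]_p) x :
  smooth_at f x -> smooth_at (fun y => f y *m M) x.
Proof.
by move=> [A [oA Ax CA]]; exists A; split=> // k; exact: Cn_mul_cst.
Qed.

Lemma smooth_at_cst W (c : W) x : smooth_at (fun=> c) x.
Proof. by exists setT; split=> //; [exact: openT|move=> k; exact: Cn_cst]. Qed.

Lemma smooth_at_id x : smooth_at id x.
Proof. by exists setT; split=> //; [exact: openT|move=> k; apply: Cn_id; exact: openT]. Qed.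

Lemma smooth_at_add W (f g : 'rV[R]_m -> W) x :
  smooth_at f x -> smooth_at g x -> smooth_at (fun y => f y + g y) x.
Proof.
move=> [A [oA Ax CA]] [B [oB Bx CB]]; exists (A `&` B); split=> //; first exact: openI.
move=> k; apply: Cn_add; first exact: openI.
  by apply: Cn_sub (CA k) => y [].
by apply: Cn_sub (CB k) => y [].
Qed.

Lemma smooth_onP p (A : set 'rV[R]_m) (f : 'rV[R]_m -> 'rV[R]_p) : open A ->
  smooth_on A f <-> forall x, A x -> smooth_at f x.
Proof.
move=> oA; split=> [CA x Ax|sf k]; first by exists A; split=> // k; apply/Ck_onE.
apply/Ck_onE; suff H : forall k (g : 'rV[R]_m -> 'rV[R]_p),
    (forall x, A x -> smooth_at g x) -> Cn k A g by exact: H.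
elim=> [|{}k IHk] g sg; first by move=> x /sg; exact: smooth_at_cont.
split=> [x /sg|v]; first exact: smooth_at_diff.
by apply: IHk => x /sg; exact: smooth_at_derive.
Qed.

End SmoothAt.

(** * Mean value theorem, strict differentiability, symmetry of second derivatives *)

Lemma is_derive_segment (R : realType) (m : nat) (h : 'rV[R]_m -> R) a v (t : R) :
  differentiable h (t *: v + a) ->
  is_derive t 1 (fun s : R => h (s *: v + a)) ('D_v h (t *: v + a)).
Proof.
move=> dh; have E : (fun s : R => s^-1 *: (h ((s *: (1 : R) + t) *: v + a) - h (t *: v + a)))
    = (fun s : R => s^-1 *: (h (s *: v + (t *: v + a)) - h (t *: v + a))).
  apply/funext => s; rewrite (_ : s *: (1 : R) = s); last exact: mulr1.
  by rewrite scalerDl addrA.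
apply: DeriveDef; last by rewrite /derive /= E.
by rewrite /derivable /= E; exact: diff_derivable.
Qed.

Lemma mean_value_segment (R : realType) (m : nat) (h : 'rV[R]_m -> R) a v :
  (forall t : R, 0 <= t <= 1 -> differentiable h (t *: v + a)) ->
  exists2 t, 0 < t < 1 & h (v + a) - h a = 'D_v h (t *: v + a).
Proof.
move=> dh.
have D (t : R) : t \in `[0, 1] -> is_derive t 1 (fun s : R => h (s *: v + a)) ('D_v h (t *: v + a)).
  by rewrite in_itv /= => t01; apply: is_derive_segment; exact: dh.
pose g (s : R) : R := h (s *: v + a); pose dg (t : R) : R := 'D_v h (t *: v + a).
have D1 (t : R) : t \in `]0, 1[%R -> is_derive t 1 g (dg t).
  by rewrite in_itv /= => /andP[t0 t1]; apply: D; rewrite in_itv /= !ltW.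
have D2 : {within `[0, 1], continuous g}.
  by apply: derivable_within_continuous => t /D [].
have [c] := MVT ltr01 D1 D2.
rewrite in_itv /= => c01; rewrite subr0 mulr1 /g /dg scale1r scale0r add0r => E.
by exists c.
Qed.

(** The norm is the maximum of the coordinates. Each coordinate has its own intermediate point,
    which does no harm as the bound holds along the whole segment. *)
Lemma mean_value_bound (R : realType) (m p : nat) (h : 'rV[R]_m -> 'rV[R]_p) a b (C : R) :
  0 <= C ->
  (forall t : R, 0 <= t <= 1 -> differentiable h (t *: (b - a) + a) /\
     `|'D_(b - a) h (t *: (b - a) + a)| <= C) ->
  `|h b - h a| <= C.
Proof.
move=> C0 hd; apply/norm_rV_le => // j.
have dhj (t : R) : 0 <= t <= 1 -> differentiable (fun y => h y 0 j) (t *: (b - a) + a).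
  by move=> /hd[/differentiable_mxP + _]; exact.
have [t t01] := mean_value_segment dhj.
have {}t01 : 0 <= t <= 1 by case/andP: t01 => ? ?; rewrite !ltW.
rewrite subrK !mxE => ->; have [dt le] := hd t t01.
apply: le_trans le; have := norm_coord_le ('D_(b - a) h (t *: (b - a) + a)) j.
by rewrite derive_mx ?mxE//; exact: diff_derivable.
Qed.

Lemma segment_ball (R : realType) (m : nat) (x a b : 'rV[R]_m) (d t : R) :
  0 <= t <= 1 -> `|a - x| < d -> `|b - x| < d -> `|(t *: (b - a) + a) - x| < d.
Proof.
move=> /andP[t0 t1] ad bd.
have -> : (t *: (b - a) + a) - x = t *: (b - x) + (1 - t) *: (a - x).
  rewrite scalerBl scale1r !scalerBr -!addrA; congr (_ + _).
  rewrite !opprD !opprK !addrA; apply/eqP; rewrite -subr_eq0; apply/eqP.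
  apply/rowP => i; rewrite !mxE; ring.
apply: le_lt_trans (ler_normD _ _) _; rewrite !normrZ ger0_norm// ger0_norm ?subr_ge0//.
have [->|tn0] := eqVneq t 0; first by rewrite mul0r add0r subr0 mul1r.
have tp : 0 < t by rewrite lt_neqAle eq_sym tn0.
apply: (@lt_le_trans _ _ (t * d + (1 - t) * d)); last by rewrite -mulrDl addrC subrK mul1r.
by apply: ltr_leD; [rewrite ltr_pM2l|rewrite ler_wpM2l ?subr_ge0// ltW].
Qed.

(** Strict differentiability: f minus its linear part at x has small partial derivatives near x, so
    it is Lipschitz with a small constant there. Having both [a] and [b] vary is what yields
    injectivity and contraction later. *)
Lemma smooth_at_strict (R : realType) (m p : nat) (f : 'rV[R]_m -> 'rV[R]_p) x e :
  smooth_at f x -> 0 < e ->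
  exists2 d : R, 0 < d & forall a b, `|a - x| < d -> `|b - x| < d ->
    `|f b - f a - (b - a) *m 'J f x| <= e * `|b - a|.
Proof.
(* There are [m] partial derivatives, each allowed an error [e1]; the successor keeps the quotient
   meaningful when [m] is 0. *)
move=> sf e0; set e1 := e / m.+1%:R.
have e10 : 0 < e1 by rewrite divr_gt0.
have : \forall y \near x, smooth_at f y /\ forall i : 'I_m,
    `|'D_(delta_mx 0 i) f x - 'D_(delta_mx 0 i) f y| < e1.
  apply: filterI; first exact: smooth_at_near.
  apply: (@near_forall _ x _ (fun i y => `|'D_(delta_mx 0 i) f x - 'D_(delta_mx 0 i) f y| < e1)) => i.
  by have /smooth_at_cont/continuous_at_normP := smooth_at_derive (delta_mx 0 i) sf; exact.
move=> /nbhs_normP[d /= d0 hd]; exists d => // a b ad bd.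
pose h y := f y - y *m 'J f x.
have -> : f b - f a - (b - a) *m 'J f x = h b - h a.
  by rewrite /h mulmxBl !opprB addrACA [RHS]addrACA (addrC (- f a)).
apply: mean_value_bound => [|t t01]; first by rewrite mulr_ge0// ltW.
set y := t *: _ + _; have : `|x - y| < d by rewrite distrC; exact: segment_ball.
move=> /hd[/smooth_at_diff dfy Dy].
have dm : differentiable (fun z => z *m 'J f x) y by exact: differentiable_mulmx.
split; first exact: differentiableB.
rewrite /h deriveB; [|exact: diff_derivable..].
rewrite (deriveE _ dm) diff_mulmx -diffJ -(deriveE _ (smooth_at_diff sf)).
rewrite (derive_rV _ dfy) (derive_rV _ (smooth_at_diff sf)) -sumrB.
apply: le_trans (ler_norm_sum _ _ _) _.
apply: (@le_trans _ _ (\sum_(i < m) e1 * `|b - a|)).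
  apply: ler_sum => i _; rewrite -scalerBr normrZ mulrC ler_pM ?norm_coord_le//.
  by rewrite distrC ltW.
rewrite -mulr_suml ler_wpM2r// sumr_const card_ord -mulr_natr /e1 -mulrA.
by rewrite ler_piMr ?(ltW e0)// mulrC ler_pdivrMr// mul1r ler_nat.
Qed.

Lemma derive_translate (R : realType) (m : nat) (f : 'rV[R]_m -> R) c x v :
  'D_v (fun y => f (y + c)) x = 'D_v f (x + c).
Proof.
rewrite /derive /=; have -> // : (fun h : R => h^-1 *: (f (h *: v + x + c) - f (x + c)))
  = (fun h : R => h^-1 *: (f (h *: v + (x + c)) - f (x + c))).
by apply/funext => h; rewrite addrA.
Qed.

Lemma differentiable_translate (R : realType) (m : nat) (f : 'rV[R]_m -> R) c x :
  differentiable f (x + c) -> differentiable (fun y => f (y + c)) x.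
Proof.
by move=> df; apply: (@differentiable_comp _ _ _ _ (fun y => y + c) f).
Qed.

(** The mean value theorem is applied to y |-> f(y + t w) - f(y) between x and x + t v; the two
    resulting values of D_v f are then expanded to first order at x. *)
Lemma second_difference (R : realType) (m : nat) (f : 'rV[R]_m -> R) x v w e :
  (\forall y \near x, differentiable f y) ->
  differentiable ('D_v f) x -> 0 < e ->
  exists2 d : R, 0 < d & forall t, 0 < t -> t < d ->
    `|f (t *: v + (t *: w + x)) - f (t *: v + x) - f (t *: w + x) + f x
      - t * (t * 'D_w ('D_v f) x)| <= e * t ^+ 2.
Proof.
move=> fd dF e0; set F := 'D_v f.
(* [t * N] bounds every displacement s t v and s t v + t w with s in [0, 1]; the 1 keeps [N]
   positive. Two remainders of size e1 t N and the outer factor t add up to e t^2. *)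
set N := `|v| + `|w| + 1; have N0 : 0 < N by rewrite ltr_wpDl// addr_ge0.
set e1 := e / (N + N); have e10 : 0 < e1 by rewrite divr_gt0// addr_gt0.
have /nbhs_normP[d1 /= d10 hd1] := fd.
have /nbhs_normP[d2 /= d20 hd2] := differentiable_littleo dF e10.
exists (Num.min d1 d2 / N); first by rewrite divr_gt0// lt_min d10.
move=> t t0; rewrite ltr_pdivlMr// lt_min => /andP[td1 td2].
pose small (z : 'rV[R]_m) := `|z| <= t * N.
have small1 s : 0 <= s <= 1 -> small (s *: (t *: v)).
  move=> /andP[s0 s1]; rewrite /small !normrZ ger0_norm// gtr0_norm//.
  rewrite mulrCA ler_pM2l//; apply: le_trans (ler_piMl _ s1) _ => //.
  by rewrite /N -addrA lerDl addr_ge0.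
have small2 s : 0 <= s <= 1 -> small (s *: (t *: v) + t *: w).
  move=> /andP[s0 s1]; rewrite /small; apply: le_trans (ler_normD _ _) _.
  rewrite !normrZ ger0_norm// !gtr0_norm// /N 2!mulrDr mulr1 -addrA lerD//.
    by apply: ler_piMl => //; rewrite mulr_ge0// ltW.
  by rewrite lerDl ltW.
have smd (z : 'rV[R]_m) : small z -> differentiable f (z + x).
  move=> sz; apply: hd1 => /=; rewrite distrC addrK; exact: le_lt_trans td1.
have smF (z : 'rV[R]_m) : small z -> `|F (z + x) - F x - 'd F x z| <= e1 * (t * N).
  move=> sz; have : `|0 - z| < d2 by rewrite sub0r normrN; exact: le_lt_trans td2.
  by move=> /hd2 /le_trans; apply; rewrite ler_pM2l.
pose fw y := f (y + t *: w).
pose phi y := fw y - f y.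
have dphi s : 0 <= s <= 1 -> differentiable fw (s *: (t *: v) + x).
  by move=> s01; apply: differentiable_translate; rewrite addrAC; exact: smd (small2 s s01).
have [s s01|s s01 E] := @mean_value_segment R m phi x (t *: v).
  by apply: differentiableB; [exact: dphi|exact/smd/small1].
have {}s01 : 0 <= s <= 1 by case/andP: s01 => ? ?; rewrite !ltW.
have -> : f (t *: v + (t *: w + x)) - f (t *: v + x) - f (t *: w + x) + f x =
    phi (t *: v + x) - phi x.
  by rewrite /phi /fw -(addrA _ x) (addrC x (t *: w)); ring.
rewrite E deriveB; last 2 first.
- by apply: diff_derivable; exact: dphi.
- by apply/diff_derivable/smd/small1.
rewrite derive_translate.
have dl z : small z -> 'D_(t *: v) f (z + x) = t * F (z + x).
  by move=> sz; rewrite deriveE ?linearZ /=; [rewrite -deriveE//|]; exact: smd.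
rewrite (addrAC _ x) (dl _ (small2 s s01)) (dl _ (small1 s s01)).
rewrite -mulrBr -mulrBr normrM gtr0_norm//.
rewrite [leRHS](_ : _ = t * (e1 * (t * N) + e1 * (t * N))); last first.
  by rewrite /e1; field; rewrite gt_eqF// addr_gt0.
rewrite ler_pM2l//.
have -> : t * 'D_w F x = 'd F x (t *: w) by rewrite deriveE// linearZ.
have -> : F (s *: (t *: v) + t *: w + x) - F (s *: (t *: v) + x) - 'd F x (t *: w) =
   (F (s *: (t *: v) + t *: w + x) - F x - 'd F x (s *: (t *: v) + t *: w)) -
   (F (s *: (t *: v) + x) - F x - 'd F x (s *: (t *: v))).
  by rewrite linearD; ring.
by apply: le_trans (ler_normB _ _) _; apply: lerD; apply: smF; [exact: small2|exact: small1].
Qed.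

(** The second difference is symmetric in v and w, and approximates t^2 times either mixed
    derivative. Dividing by t^2 leaves a gap of at most [e], for every [e]. *)
Lemma Schwarz (R : realType) (m : nat) (f : 'rV[R]_m -> R) x v w :
  (\forall y \near x, differentiable f y) ->
  differentiable ('D_v f) x -> differentiable ('D_w f) x ->
  'D_w ('D_v f) x = 'D_v ('D_w f) x.
Proof.
move=> fd dv dw; apply/eqP; rewrite -subr_eq0 -normr_le0; apply/ler_addgt0Pl => e e0.
rewrite addr0; have e20 : 0 < e / 2 by rewrite divr_gt0.
have [d1 d10 h1] := second_difference w fd dv e20.
have [d2 d20 h2] := second_difference v fd dw e20.
have d0 : 0 < Num.min d1 d2 by rewrite lt_min d10.
pose t := Num.min d1 d2 / 2.
have t0 : 0 < t by rewrite divr_gt0.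
have : t < Num.min d1 d2 by rewrite /t ltr_pdivrMr// ltr_pMr// ltr1n.
rewrite lt_min => /andP[td1 td2].
have H1 := h1 t t0 td1; have := h2 t t0 td2.
rewrite [t *: w + (_ + _)]addrCA => H2.
set A := 'D_w _ x in H1 *; set B := 'D_v _ x in H2 *.
set D := (X in `|X - _| <= _) in H1; set D' := (X in `|X - _| <= _) in H2.
have DD : D = D' by rewrite /D /D' -addrA [in RHS]addrAC -[in RHS]addrA; ring.
have t20 : 0 < t ^+ 2 by rewrite exprn_gt0.
rewrite -(ler_pM2l t20) -[X in X * `|_|](gtr0_norm t20) -normrM.
rewrite [X in `|X|](_ : _ = (D' - t * (t * B)) - (D - t * (t * A))); last by rewrite DD; ring.
apply: le_trans (ler_normB _ _) _; apply: le_trans (lerD H2 H1) _.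
by rewrite -mulrDl -splitr mulrC.
Qed.

(** * The inverse function theorem *)

Lemma jacobianE (R : realType) (m p : nat) (f : 'rV[R]_m -> 'rV[R]_p) y i j :
  differentiable f y -> 'J f y i j = 'D_(delta_mx 0 i) f y 0 j.
Proof.
by move=> df; rewrite deriveE// diffJ -rowE [RHS]mxE.
Qed.

Lemma Cn_jacobian (R : realType) (m p k : nat) (A : set 'rV[R]_m)
    (f : 'rV[R]_m -> 'rV[R]_p) : open A ->
  Cn k.+1 A f -> Cn k A (fun y => 'J f y).
Proof.
move=> oA [df Df]; apply/Cn_mxP => // i j.
apply: Cn_ext ((Cn_mxP k _ oA).1 (Df (delta_mx 0 i)) 0 j) => // y Ay.
by rewrite jacobianE//; exact: df.
Qed.

Lemma smooth_at_jacobian (R : realType) (m p : nat)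
    (f : 'rV[R]_m -> 'rV[R]_p) x : smooth_at f x -> smooth_at (fun y => 'J f y) x.
Proof.
by move=> [A [oA Ax CA]]; exists A; split=> // k; apply: Cn_jacobian => //.
Qed.

Lemma smooth_at_unit_near (R : realType) (m n : nat) (f : 'rV[R]_m -> 'M[R]_n) x :
  smooth_at f x -> f x \in unitmx -> \forall y \near x, f y \in unitmx.
Proof.
move=> [A [oA Ax CA]]; rewrite unitmxE unitfE => d0.
have /continuous_at_normP := Cn_det oA (CA 0%N) x Ax.
move=> /(_ `|\det (f x)|); rewrite normr_gt0 => /(_ d0).
apply: filterS => y; rewrite unitmxE unitfE; apply: contraTneq => ->.
by rewrite subr0 ltxx.
Qed.

Section MatrixCompleteNormed.
Variables (R : realType) (m n : nat).
HB.instance Definition _ := Complete.on 'M[R]_(m, n).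
End MatrixCompleteNormed.

Lemma closed_normball (R : realType) (n : nat) (x0 : 'rV[R]_n) (r : R) :
  closed [set x : 'rV[R]_n | `|x - x0| <= r].
Proof.
have -> : [set x : 'rV[R]_n | `|x - x0| <= r] =
  (fun x : 'rV[R]_n => `|x - x0|) @^-1` [set y | y <= r] by [].
apply: closed_comp; last exact: closed_le.
move=> x _; apply/continuous_at_normP => e e0.
apply: filterS (near_dist_lt x e0) => y; apply: le_lt_trans.
by apply: le_trans (ler_dist_dist _ _) _; rewrite opprB addrA subrK.
Qed.

Lemma fixed_point_ball (R : realType) (n : nat) (T : 'rV[R]_n -> 'rV[R]_n) x0 (r : R) :
  0 <= r ->
  (forall x, `|x - x0| <= r -> `|T x - x0| <= r) ->
  (forall a b, `|a - x0| <= r -> `|b - x0| <= r -> `|T a - T b| <= 2^-1 * `|a - b|) ->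
  exists2 x, `|x - x0| <= r & T x = x.
Proof.
move=> r0 TU Tc; pose U := [set x : 'rV[R]_n | `|x - x0| <= r].
have fT : set_fun U U T by move=> x; exact: TU.
pose T' : {fun U >-> U} := HB.pack_for {fun U >-> U} T (isFun.Build _ _ U U T fT).
have cT : is_contraction T'.
  exists ((2^-1 : R)%:nng); split => /=; first by rewrite invf_lt1// ltr1n.
  by move=> -[a b] [/= Ua Ub]; exact: Tc.
have cU : closed U by exact: closed_normball.
have [|x Ux xE] := @banach_fixed_point R 'rV[R]_n U T' cT cU.
  by exists x0; rewrite /U /= subrr normr0.
by exists x.
Qed.

(** F x = y is solved by the Newton iteration with the derivative frozen at x0, a contraction of a
    closed ball. The resulting inverse is Lipschitz, hence differentiable with derivative the
    inverse of 'J F at G y, and this formula raises its regularity one order at a time. *)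
Theorem inverse_function (R : realType) (n : nat) (F : 'rV[R]_n -> 'rV[R]_n) x0 :
  smooth_at F x0 -> 'J F x0 \in unitmx ->
  exists G : 'rV[R]_n -> 'rV[R]_n,
  [/\ smooth_at G (F x0), G (F x0) = x0,
      \forall x \near x0, G (F x) = x & \forall y \near F x0, F (G y) = y].
Proof.
move=> sF uF.
set J0 := 'J F x0 in uF *; have [C C0 hC] := mulmx_bound (invmx J0).
have [A [oA Ax CA]] := sF.
(* As [C] bounds the inverse of [J0], this error makes F followed by that inverse differ from the
   identity by a map of Lipschitz constant 1/2. *)
have e0 : 0 < (2 * C)^-1 by rewrite invr_gt0 mulr_gt0.
have [d1 d10 strict] := smooth_at_strict sF e0.
have : \forall y \near x0, A y /\ 'J F y \in unitmx.
  apply: filterI; first by apply: open_nbhs_nbhs; split.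
  exact: (smooth_at_unit_near (smooth_at_jacobian sF)).
move=> /nbhs_normP[d2 /= d20 hd2].
pose r := Num.min d1 d2 / 2.
have r0 : 0 < r by rewrite divr_gt0// lt_min d10.
have rd : r < Num.min d1 d2 by rewrite /r ltr_pdivrMr// ltr_pMr ?ltr1n// lt_min d10.
have /andP[rd1 rd2] : (r < d1) && (r < d2) by rewrite -lt_min.
have AU x : `|x - x0| <= r -> A x /\ 'J F x \in unitmx.
  by move=> xr; apply: hd2; rewrite /= distrC; exact: le_lt_trans rd2.
have key a b : `|a - x0| <= r -> `|b - x0| <= r ->
    `|(F b - F a) *m invmx J0 - (b - a)| <= 2^-1 * `|b - a|.
  move=> ar br; have := strict a b (le_lt_trans ar rd1) (le_lt_trans br rd1).
  rewrite -/J0 -(ler_pM2l C0) => h.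
  have -> : (F b - F a) *m invmx J0 - (b - a) = (F b - F a - (b - a) *m J0) *m invmx J0.
    by rewrite [RHS]mulmxBl -mulmxA mulmxV// mulmx1.
  apply: le_trans (hC _) _; apply: le_trans h _.
  by rewrite mulrA invfM mulrCA mulfV ?gt_eqF// mulr1.
have lip a b : `|a - x0| <= r -> `|b - x0| <= r -> `|b - a| <= 2 * C * `|F b - F a|.
  move=> ar br; have := key a b ar br; set w := _ *m _; move=> h.
  have h2 : `|b - a| <= `|w| + 2^-1 * `|b - a|.
    rewrite -[X in `|X| <= _](subrK w) addrC; apply: le_trans (ler_normD _ _) _.
    by rewrite lerD2l distrC.
  have h3 : `|w| <= C * `|F b - F a| by exact: hC.
  by move: h2 h3; set X := `|b - a|; set Y := `|w|; set Z := C * _; rewrite -mulrA -/Z; lra.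
(* Chosen so that [C * rho] is r/2: the target y displaces the centre by at most r/2, and the
   contraction contributes the other half. *)
pose rho := r / (2 * C).
have rho0 : 0 < rho by rewrite divr_gt0// mulr_gt0.
pose V := [set y | `|F x0 - y| < rho].
have oV : open V.
  have -> : V = ball (F x0) rho by rewrite -ball_normE.
  exact: ball_open.
have VF : V (F x0) by rewrite /V /= subrr normr0.
have sol y : V y -> exists x, `|x - x0| <= r /\ F x = y.
  move=> Vy; pose T x := x + (y - F x) *m invmx J0.
  have [||x xr] := @fixed_point_ball R n T x0 r (ltW r0).
  - move=> x xr; have x0r : `|x0 - x0| <= r by rewrite subrr normr0 ltW.
    have := key x0 x x0r xr; set w := _ *m _; move=> h.
    have -> : T x - x0 = - (w - (x - x0)) + (y - F x0) *m invmx J0.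
      have -> : T x = x + ((y - F x0) *m invmx J0 - w).
        by rewrite /T /w -mulmxBl opprB subrKA.
      by rewrite opprB addrAC (addrC (_ *m _)) addrA.
    apply: le_trans (ler_normD _ _) _; rewrite normrN.
    apply: (@le_trans _ _ (2^-1 * r + C * rho)).
      apply: lerD; first by apply: le_trans h _; rewrite ler_wpM2l.
      by apply: le_trans (hC _) _; rewrite ler_pM2l// distrC ltW.
    rewrite (_ : C * rho = 2^-1 * r); last by rewrite /rho; field; rewrite gt_eqF.
    by rewrite -mulrDl -[X in _ <= X]mul1r ler_wpM2r ?(ltW r0)//; lra.
  - move=> a b ar br; have := key b a br ar; rewrite -normrN opprB.
    rewrite /T [X in _ -> `|X| <= _](_ : _ = a - b - (F a - F b) *m invmx J0)//.
    rewrite opprD addrACA; congr (_ + _).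
    by rewrite -mulmxBl -mulNmx opprB (addrC (y - _)) subrKA opprB.
  - rewrite /T -[X in _ = X]addr0 => /addrI E; exists x; split=> //.
    apply/eqP; rewrite eq_sym -subr_eq0; apply/eqP.
    by rewrite -[LHS](mulmxKV uF) E mul0mx.
(* Off [V] the value is the default [x0] whenever the ball contains no solution; only values on [V]
   are used. *)
pose G y := xget x0 [set x | `|x - x0| <= r /\ F x = y].
have GP y : V y -> `|G y - x0| <= r /\ F (G y) = y.
  by move=> /sol; exact: xgetPex.
have inj a b : `|a - x0| <= r -> `|b - x0| <= r -> F a = F b -> a = b.
  move=> ar br Fab; apply/eqP; rewrite eq_sym -subr_eq0 -normr_le0.
  by have := lip a b ar br; rewrite Fab subrr normr0 mulr0.
have GF x : `|x - x0| <= r -> V (F x) -> G (F x) = x.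
  by move=> xr /GP[gr FG]; exact: inj.
have dG y : V y -> differentiable G y /\ forall v, 'd G y v = v *m invmx ('J F (G y)).
  move=> Vy; have [xr FG] := GP y Vy; set x := G y in xr FG *; set L := invmx ('J F x).
  have [Axx ux] := AU x xr.
  have [K K0 hK] := mulmx_bound L.
  suff [dGy dE] : differentiable G y /\ 'd G y = mulmxr L :> (_ -> _).
    by split=> // v; rewrite dE.
  apply: differentiable_linear_approx; first exact: mulmx_continuous.
  (* [K] bounds the inverse derivative at x and 2C is the Lipschitz constant of the inverse; both
     enter when the remainder of F is carried over to G. *)
  move=> e ep; have e1 : 0 < e / (2 * C * K) by rewrite divr_gt0// !mulr_gt0.
  have /nbhs_normP[d3 /= d30 hd3] := differentiable_littleo ((CA 1).1 x Axx) e1.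
  have d40 : 0 < d3 / (2 * C) by rewrite divr_gt0// mulr_gt0.
  have nV : \forall h \near (0 : 'rV[R]_n), V (h + y).
    rewrite (near_shift y) /=.
    apply: filterS (open_nbhs_nbhs (conj oV Vy)) => z; rewrite /= sub0r subrK.
    exact.
  apply: filterS2 nV (near_dist_lt (0 : 'rV[R]_n) d40) => h Vh hd.
  rewrite sub0r normrN ltr_pdivlMr ?mulr_gt0// in hd.
  have [gr Fg] := GP _ Vh.
  have kle : `|G (h + y) - x| <= 2 * C * `|h|.
    by have := lip _ _ xr gr; rewrite Fg FG addrK.
  have kd : `|0 - (G (h + y) - x)| < d3.
    by rewrite sub0r normrN; apply: le_lt_trans kle _; rewrite mulrC.
  have := hd3 _ kd; rewrite subrK Fg FG addrK diffJ => hh.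
  have -> : G (h + y) - x - mulmxr L h = - ((h - (G (h + y) - x) *m 'J F x) *m L).
    by rewrite mulmxBl -mulmxA mulmxV// mulmx1 opprB.
  rewrite normrN; apply: le_trans (hK _) _.
  apply: (@le_trans _ _ (K * (e / (2 * C * K) * (2 * C * `|h|)))).
    rewrite ler_pM2l//; apply: le_trans hh _.
    by rewrite ler_pM2l.
  rewrite [leLHS](_ : _ = e * `|h|)//; field.
  by rewrite !gt_eqF.
exists G; split.
(* If G is of class C^k, then so is y |-> ('J F (G y))^-1, which is its derivative; hence G is of
   class C^(k+1). *)
- exists V; split=> // k; elim: k => [|k IHk].
    by move=> y /dG[/differentiable_continuous].
  split=> [y /dG[]//|v].
  have CJ : Cn k V (fun y => 'J F (G y)).
    by apply: (@Cn_comp _ _ _ _ _ k V A G (fun y => 'J F y)) => //;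
      [move=> y /GP[/AU[]]|exact: Cn_jacobian].
  have CI := Cn_invmx oV (fun y Vy => (AU _ (GP y Vy).1).2) CJ.
  apply: Cn_ext (Cn_mulmx oV (Cn_cst k V v) CI) => // y /dG[dGy dE].
  by rewrite deriveE// dE.
- by apply: GF => //; rewrite subrr normr0 ltW.
- have cF := smooth_at_cont sF.
  have nV : \forall x \near x0, V (F x) by apply: cF; apply: open_nbhs_nbhs; split.
  apply: filterS2 nV (near_dist_lt x0 r0) => x Vx xr; apply: GF => //.
  by rewrite distrC ltW.
- by apply: filterS (open_nbhs_nbhs (conj oV VF)) => y /GP[].
Qed.

(** * Charts and smooth maps of manifolds *)

Lemma mulmx_ext (R : realType) (m n : nat) (A B : 'M[R]_(m, n)) :
  (forall v : 'rV[R]_m, v *m A = v *m B) -> A = B.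
Proof. by move=> AB; apply/row_matrixP => i; rewrite !rowE. Qed.

Lemma jacobian_comp (R : realType) (m p q : nat) (f : 'rV[R]_m -> 'rV[R]_p)
    (g : 'rV[R]_p -> 'rV[R]_q) x :
  differentiable f x -> differentiable g (f x) ->
  'J (g \o f) x = 'J f x *m 'J g (f x).
Proof.
move=> df dg; apply: mulmx_ext => v.
by rewrite mulmxA -diffJ -(diffJ f) -(diffJ g) diff_comp.
Qed.

Lemma near_eq_jacobian (R : realType) (m p : nat) (f g : 'rV[R]_m -> 'rV[R]_p) x :
  (\forall y \near x, f y = g y) -> differentiable f x -> 'J f x = 'J g x.
Proof.
move=> fg df; have [_ E] := near_eq_differentiable fg df.
apply: mulmx_ext => v; apply: (etrans (esym (diffJ f x v))).
apply: etrans (diffJ g x v).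
exact: (esym (congr1 (fun h => h v) E)).
Qed.

Lemma jacobian_id (R : realType) (m : nat) (x : 'rV[R]_m) : 'J id x = 1%:M.
Proof.
apply: mulmx_ext => v; rewrite mulmx1; apply: etrans (esym (diffJ id x v)) _.
have did : differentiable id x := smooth_at_diff (smooth_at_id x).
exact: eq_trans (esym (deriveE v did)) (derive_id x v).
Qed.

Section Charts.
Variables (R : realType) (m : nat) (M : manifold R m).
Implicit Types x y z : M.

Lemma chart_image_nbhs x y (P : set M) : dom M x y -> nbhs y P ->
  \forall u \near chart M x y, P (chart_inv M x u).
Proof.
move=> dxy yP; have : nbhs (chart_inv M x (chart M x y)) P by rewrite chartK.
by apply: (@chart_inv_continuous _ _ M x); exists y.
Qed.

Lemma near_chart x y : dom M x y -> \forall z \near y, dom M x z.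
Proof. by move=> dxy; apply: open_nbhs_nbhs; split=> //; exact: dom_open. Qed.

Lemma near_chart_inv x y : dom M x y ->
  \forall u \near chart M x y, dom M x (chart_inv M x u) /\ chart M x (chart_inv M x u) = u.
Proof.
move=> dxy; have : nbhs (chart M x y) (chart M x @` dom M x).
  by apply: open_nbhs_nbhs; split; [exact: codom_open|exists y].
by apply: filterS => _ [z dz <-]; rewrite chartK.
Qed.

Lemma chart_preimage_nbhs x y (P : set 'rV[R]_m) : dom M x y -> nbhs (chart M x y) P ->
  \forall z \near y, P (chart M x z).
Proof. by move=> dxy uP; exact: (@chart_continuous _ _ M x y dxy). Qed.

Lemma chart_image_open x (V : set M) : open V -> open (chart M x @` (dom M x `&` V)).
Proof.
move=> oV; rewrite openE => _ [y [dy Vy] <-].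
have := near_chart_inv dy; have := chart_image_nbhs dy (open_nbhs_nbhs (conj oV Vy)).
by apply: filterS2 => u Vu [du Eu]; exists (chart_inv M x u).
Qed.

End Charts.

(** [in_charts f x] is the case of the distinguished charts at x and f x. Since those change with
    the point, any statement on a neighbourhood needs charts with fixed centres. *)
Definition loc (R : realType) (m p : nat) (M : manifold R m) (N : manifold R p)
    (x0 : M) (y0 : N) (f : M -> N) : 'rV[R]_m -> 'rV[R]_p :=
  chart N y0 \o f \o chart_inv M x0.

Definition mJ (R : realType) (m p : nat) (M : manifold R m) (N : manifold R p)
    (f : M -> N) (x : M) : 'M[R]_(m, p) :=
  'J (in_charts f x) (chart M x x).

Lemma mdiffE (R : realType) (m p : nat) (M : manifold R m) (N : manifold R p)
    (f : M -> N) (x : M) v : mdiff f x v = v *m mJ f x.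
Proof. exact: diffJ. Qed.

Section Loc.
Variables (R : realType) (m p q : nat).
Variables (M : manifold R m) (N : manifold R p) (Q : manifold R q).

Lemma loc_chart (f : M -> N) x0 y0 x : dom M x0 x ->
  loc x0 y0 f (chart M x0 x) = chart N y0 (f x).
Proof. by move=> dx; rewrite /loc /= chartK. Qed.

Lemma loc_comp_near (f : M -> N) (g : N -> Q) x0 y0 z0 x :
  dom M x0 x -> dom N y0 (f x) -> {for x, continuous f} ->
  \forall u \near chart M x0 x, (loc y0 z0 g \o loc x0 y0 f) u = loc x0 z0 (g \o f) u.
Proof.
move=> dx dy cf; have := chart_image_nbhs dx (cf _ (near_chart dy)).
by apply: filterS => u /= du; rewrite /loc /= chartK.
Qed.

Lemma loc_comp (f : M -> N) (g : N -> Q) x0 y0 z0 x :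
  dom M x0 x -> dom N y0 (f x) -> {for x, continuous f} ->
  smooth_at (loc x0 y0 f) (chart M x0 x) -> smooth_at (loc y0 z0 g) (chart N y0 (f x)) ->
  smooth_at (loc x0 z0 (g \o f)) (chart M x0 x) /\
  'J (loc x0 z0 (g \o f)) (chart M x0 x) =
  'J (loc x0 y0 f) (chart M x0 x) *m 'J (loc y0 z0 g) (chart N y0 (f x)).
Proof.
move=> dx dy cf sf sg; have E := loc_comp_near g z0 dx dy cf.
rewrite -(loc_chart f y0 dx) in sg *.
have sgf : smooth_at (loc y0 z0 g \o loc x0 y0 f) (chart M x0 x) by exact: smooth_at_comp.
split; first exact: smooth_at_ext E sgf.
rewrite -(near_eq_jacobian E); last exact: smooth_at_diff.
by rewrite jacobian_comp//; exact: smooth_at_diff.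
Qed.

End Loc.

Lemma transition_smooth (R : realType) (m : nat) (M : manifold R m) (x y z : M) :
  dom M x z -> dom M y z -> smooth_at (loc x y (@id M)) (chart M x z).
Proof.
move=> dx dy; have := @chart_smooth _ _ M x y; move/smooth_onP; apply.
  by apply: chart_image_open; exact: dom_open.
by exists z.
Qed.

Lemma id_for_continuous (T : topologicalType) (x : T) : {for x, continuous (@id T)}.
Proof. exact: cvg_id. Qed.

Lemma transition_jacobian (R : realType) (m : nat) (M : manifold R m) (x y z : M) :
  dom M x z -> dom M y z ->
  'J (loc x y (@id M)) (chart M x z) *m 'J (loc y x (@id M)) (chart M y z) = 1%:M.
Proof.
move=> dx dy; have [_ <-] := loc_comp dx dy (@id_for_continuous M z)
  (transition_smooth dx dy) (transition_smooth dy dx).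
rewrite -[RHS](jacobian_id (chart M x z)); apply: near_eq_jacobian.
  by apply: filterS (near_chart_inv dx) => u [].
apply: smooth_at_diff; have := transition_smooth dx dx; exact.
Qed.

Lemma transition_unit (R : realType) (m : nat) (M : manifold R m) (x y z : M) :
  dom M x z -> dom M y z -> 'J (loc x y (@id M)) (chart M x z) \in unitmx.
Proof. by move=> dx dy; exact: (mulmx1_unit (transition_jacobian dx dy)).1. Qed.

Section SmoothMap.
Variables (R : realType) (m p : nat) (M : manifold R m) (N : manifold R p).
Implicit Types (f : M -> N).

Lemma loc_change f (x0 x1 : M) (y0 y1 : N) x :
  dom M x0 x -> dom M x1 x -> dom N y0 (f x) -> dom N y1 (f x) ->
  {for x, continuous f} -> smooth_at (loc x0 y0 f) (chart M x0 x) ->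
  smooth_at (loc x1 y1 f) (chart M x1 x) /\
  'J (loc x1 y1 f) (chart M x1 x) = 'J (loc x1 x0 (@id M)) (chart M x1 x) *m
    'J (loc x0 y0 f) (chart M x0 x) *m 'J (loc y0 y1 (@id N)) (chart N y0 (f x)).
Proof.
move=> dx0 dx1 dy0 dy1 cf sf.
have [s1 J1] := loc_comp dx1 dx0 (@id_for_continuous M x) (transition_smooth dx1 dx0) sf.
have [s2 J2] := loc_comp dx1 dy0 cf s1 (transition_smooth dy0 dy1).
by split=> //; rewrite J2 J1.
Qed.

(** Transition maps being smooth, one pair of charts around each point is enough to test
    smoothness. *)
Lemma smooth_mapP f : smooth_map f <->
  continuous f /\ forall x, exists x0 y0, [/\ dom M x0 x, dom N y0 (f x) &
    smooth_at (loc x0 y0 f) (chart M x0 x)].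
Proof.
have oA x : continuous f -> open (chart M x @` (dom M x `&` f @^-1` dom N (f x))).
  move=> cf; apply: chart_image_open; apply: open_comp => //; exact: dom_open.
split=> -[cf sf]; split=> // x.
  exists x, (f x); split; try exact: dom_self.
  have /smooth_onP := sf x; apply; first exact: oA.
  by exists x => //; split; exact: dom_self.
apply/smooth_onP; first exact: oA.
move=> _ [x' [dx' /= dfx'] <-].
have [x0 [y0 [d0 e0 s0]]] := sf x'.
by have [] := loc_change d0 dx' e0 dfx' (cf x') s0.
Qed.

Lemma smooth_map_loc f x0 y0 x : smooth_map f -> dom M x0 x -> dom N y0 (f x) ->
  smooth_at (loc x0 y0 f) (chart M x0 x).
Proof.
move=> /smooth_mapP[cf sf] dx dy.
have [x1 [y1 [d1 e1 s1]]] := sf x.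
by have [] := loc_change d1 dx e1 dy (cf x) s1.
Qed.

(** The outer factors are Jacobians of transition maps, hence invertible: a rank may be read in
    fixed charts. *)
Lemma smooth_map_mJ f x0 y0 x : smooth_map f -> dom M x0 x -> dom N y0 (f x) ->
  'J (loc x0 y0 f) (chart M x0 x) = 'J (loc x0 x (@id M)) (chart M x0 x) *m
    mJ f x *m 'J (loc (f x) y0 (@id N)) (chart N (f x) (f x)).
Proof.
move=> sf dx dy; have [_ ->] := loc_change (dom_self x) dx (dom_self (f x)) dy
  (sf.1 x) (smooth_map_loc sf (dom_self x) (dom_self (f x))).
by [].
Qed.

End SmoothMap.

Lemma smooth_map_comp (R : realType) (m p q : nat)
    (M : manifold R m) (N : manifold R p) (Q : manifold R q) (f : M -> N) (g : N -> Q) :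
  smooth_map f -> smooth_map g ->
  smooth_map (g \o f) /\ forall x, mJ (g \o f) x = mJ f x *m mJ g (f x).
Proof.
move=> sf sg.
have H x := loc_comp (dom_self x) (dom_self (f x)) (sf.1 x)
  (smooth_map_loc sf (dom_self x) (dom_self (f x)))
  (smooth_map_loc sg (dom_self (f x)) (dom_self (g (f x)))).
split=> [|x]; last by have [_] := H x.
apply/smooth_mapP; split=> [x|x]; first by apply: continuous_comp; [exact: sf.1|exact: sg.1].
by exists x, (g (f x)); split; [exact: dom_self|exact: dom_self|exact: (H x).1].
Qed.

Lemma injective_mdiffP (R : realType) (m p : nat) (M : manifold R m) (N : manifold R p)
    (f : M -> N) x : injective (mdiff f x) <-> row_free (mJ f x).
Proof.
split=> [inj|rf u v]; last by rewrite !mdiffE => /(row_free_inj rf).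
apply/inj_row_free => v /eqP; rewrite -mdiffE => /eqP E.
by apply: inj; rewrite E mdiffE mul0mx.
Qed.

(** Continuity is the topological half of the embedding. Smoothness comes from a local left inverse
    of [i]: follow it by a linear map inverting its differential at the point and apply the inverse
    function theorem. *)
Lemma embedding_lift (R : realType) (m p q : nat)
    (M : manifold R m) (N : manifold R p) (Q : manifold R q)
    (f : Q -> M) (i : N -> M) (j : Q -> N) :
  smooth_map f -> embedding i -> (forall z, i (j z) = f z) -> smooth_map j.
Proof.
move=> sf [[si di] _ ei] ij.
have cj : continuous j.
  apply/continuousP => U /ei[V oV ->].
  rewrite -[_ @^-1` _]/((i \o j) @^-1` V) (_ : i \o j = f); last exact/funext.
  by move: V oV; apply/continuousP; exact: sf.1.
apply/smooth_mapP; split=> // z; exists z, (j z); split; try exact: dom_self.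
set x := j z; have /row_freeP[P PE] := (injective_mdiffP i x).1 (di x).
have dx := dom_self x; have dz := dom_self z; have dm := dom_self (f z).
have dm' : dom M (f z) (i x) by rewrite ij.
set u0 := chart N x x.
have sa := smooth_map_loc si dx (dom_self (i x)).
(* [F] has Jacobian 1 at [u0], so it has a smooth local inverse [G]; in charts the lift is f, then
   [P], then [G]. *)
pose F u := loc x (i x) i u *m P.
have sF : smooth_at F u0 by exact: smooth_at_mul_cst.
have JF : 'J F u0 = 1%:M.
  have -> : F = (fun w => w *m P) \o loc x (i x) i by [].
  rewrite jacobian_comp; [|exact: smooth_at_diff|exact: differentiable_mulmx].
  rewrite -[RHS]PE; congr (_ *m _).
  by apply: mulmx_ext => v; rewrite -diffJ diff_mulmx.
have uF : 'J F u0 \in unitmx by rewrite JF unitmx1.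
have [G [sG _ GF _]] := inverse_function sF uF.
have sb := smooth_map_loc sf dz dm.
have F0 : loc z (f z) f (chart Q z z) *m P = F u0.
  by rewrite /F !loc_chart// ij.
have sGb : smooth_at (G \o (fun u => loc z (f z) f u *m P)) (chart Q z z).
  by apply: smooth_at_comp; [exact: smooth_at_mul_cst|rewrite F0].
apply: smooth_at_ext sGb.
have cjz : {for z, continuous j} by exact: cj.
have near1 := loc_comp_near i (i x) dz (dom_self (j z)) cjz.
have near2 : \forall u \near chart Q z z, G (F (loc z x j u)) = loc z x j u.
  have : nbhs z (fun y => G (F (chart N x (j y))) = chart N x (j y)).
    exact: (cjz _ (chart_preimage_nbhs dx GF)).
  by move=> /(chart_image_nbhs dz).
apply: filterS2 near1 near2 => u /= E1 E2.
rewrite -[RHS]E2; congr G; rewrite /F; congr (_ *m P).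
by apply: esym; apply: etrans E1 _; rewrite /loc /= /x !ij.
Qed.

(** * Pointwise contact linear algebra *)

Lemma pairingE (R : realType) (m : nat) (a v : 'rV[R]_m) : pairing a v = \sum_i a 0 i * v 0 i.
Proof. by rewrite /pairing mxE; apply: eq_bigr => i _; rewrite mxE. Qed.

Lemma pairingC (R : realType) (m : nat) (a v : 'rV[R]_m) : pairing a v = pairing v a.
Proof. by rewrite !pairingE; apply: eq_bigr => i _; rewrite mulrC. Qed.

Lemma pairingDl (R : realType) (m : nat) (a b v : 'rV[R]_m) :
  pairing (a + b) v = pairing a v + pairing b v.
Proof. by rewrite /pairing mulmxDl mxE. Qed.

Lemma pairingZl (R : realType) (m : nat) c (a v : 'rV[R]_m) :
  pairing (c *: a) v = c * pairing a v.
Proof. by rewrite /pairing -scalemxAl mxE. Qed.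

Lemma pairingNl (R : realType) (m : nat) (a v : 'rV[R]_m) :
  pairing (- a) v = - pairing a v.
Proof. by rewrite /pairing mulNmx mxE. Qed.

Lemma pairingDr (R : realType) (m : nat) (a b v : 'rV[R]_m) :
  pairing v (a + b) = pairing v a + pairing v b.
Proof. by rewrite !(pairingC v) pairingDl. Qed.

Lemma pairingZr (R : realType) (m : nat) c (a v : 'rV[R]_m) :
  pairing v (c *: a) = c * pairing v a.
Proof. by rewrite !(pairingC v) pairingZl. Qed.

Lemma pairing0l (R : realType) (m : nat) (v : 'rV[R]_m) : pairing 0 v = 0.
Proof. by rewrite /pairing mul0mx mxE. Qed.

Lemma pairing0r (R : realType) (m : nat) (v : 'rV[R]_m) : pairing v 0 = 0.
Proof. by rewrite pairingC pairing0l. Qed.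

Lemma pairing_sumr (R : realType) (m : nat) (I : finType) (P : pred I)
    (F : I -> 'rV[R]_m) (v : 'rV[R]_m) :
  pairing v (\sum_(i | P i) F i) = \sum_(i | P i) pairing v (F i).
Proof.
elim/big_rec2: _ => [|i x y _ <-]; first by rewrite pairing0r.
by rewrite pairingDr.
Qed.

Lemma pairing_mulmx (R : realType) (m p : nat) (a : 'rV[R]_m) (A : 'M[R]_(m, p)) v :
  pairing (a *m A) v = pairing a (v *m A^T).
Proof. by rewrite /pairing trmx_mul trmxK mulmxA. Qed.

(** * Nondegeneracy from the volume form *)

Section ContactVolume.
Variables (R : realType) (n : nat) (M : manifold R n.*2.+1) (eta : oneform M) (x : M).
Local Notation N := n.*2.+1.
Local Notation e := (eta x).
Local Notation A := (dform eta x).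

Let term (u : 'I_N -> 'rV[R]_N) : R :=
  pairing e (u ord0) *
     \prod_(i < n) dform2 eta x (u (inord i.*2.+1)) (u (inord i.*2.+2)).

Let upd (u : 'I_N -> 'rV[R]_N) (p : 'I_N) (y : 'rV[R]_N) : 'I_N -> 'rV[R]_N :=
  fun q => if q == p then y else u q.

(** Slot 0 of the volume belongs to eta; slots 2i+1 and 2i+2 belong to the i-th factor d eta. *)
Lemma slot_cases (p : 'I_N) : p = ord0 \/
  exists i : 'I_n, p = inord i.*2.+1 \/ p = inord i.*2.+2.
Proof.
have [->|p0] := eqVneq p ord0; first by left.
right; have pp : (0 < p)%N by rewrite lt0n.
have E := odd_double_half p.-1; have ltp := ltn_ord p.
have hn : (p.-1./2 < n)%N by lia.
exists (Ordinal hn); rewrite /=; move: hn E; set h := p.-1./2 => hn E.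
case: (odd p.-1) E => /= E; [right|left]; apply: val_inj; rewrite /= inordK; lia.
Qed.

(** Each summand is linear in each slot, and the covector representing it kills the common kernel of
    eta and d eta, because the slot sits in exactly one factor. *)
Lemma term_linear u p : exists a, (forall y, term (upd u p y) = pairing a y) /\
  (forall w, w *m A = 0 -> pairing e w = 0 -> pairing a w = 0).
Proof.
have inS (i : 'I_n) : (i.*2.+2 < N)%N by rewrite ltnS -doubleS leq_double.
have v1 (i : 'I_n) : (inord i.*2.+1 : 'I_N) = i.*2.+1 :> nat by rewrite inordK// ltnW.
have v2 (i : 'I_n) : (inord i.*2.+2 : 'I_N) = i.*2.+2 :> nat by rewrite inordK.
have d12 (i j : 'I_n) : ((inord i.*2.+1 : 'I_N) == inord j.*2.+2) = false.
  apply/negbTE/eqP => /(congr1 val) /=; rewrite v1 v2 => /(congr1 odd) /=.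
  by rewrite !odd_double.
have d11 (i j : 'I_n) : i != j -> ((inord i.*2.+1 : 'I_N) == inord j.*2.+1) = false.
  move=> /eqP ij; apply/negbTE/eqP => /(congr1 val) /=; rewrite !v1 => -[] /double_inj E.
  by apply: ij; apply: val_inj.
have d22 (i j : 'I_n) : i != j -> ((inord i.*2.+2 : 'I_N) == inord j.*2.+2) = false.
  move=> /eqP ij; apply/negbTE/eqP => /(congr1 val) /=; rewrite !v2 => -[] /double_inj E.
  by apply: ij; apply: val_inj.
have d01 (i : 'I_n) : ((inord i.*2.+1 : 'I_N) == ord0) = false.
  by apply/negbTE/eqP => /(congr1 val) /=; rewrite v1.
have d02 (i : 'I_n) : ((inord i.*2.+2 : 'I_N) == ord0) = false.
  by apply/negbTE/eqP => /(congr1 val) /=; rewrite v2.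
have AT w : w *m A = 0 -> w *m A^T = 0.
  move=> wA; suff -> : A^T = - A by rewrite mulmxN wA oppr0.
  by apply/matrixP => i j; rewrite !mxE opprB.
have [->|[i [->|->]]] := slot_cases p.
- exists ((\prod_(i < n) dform2 eta x (u (inord i.*2.+1)) (u (inord i.*2.+2))) *: e).
  split=> [y|w _ ew]; last by rewrite pairingZl ew mulr0.
  rewrite /term /upd eqxx pairingZl mulrC; congr (_ * _).
  by apply: eq_bigr => i _; rewrite d01 d02.
- pose c := pairing e (u ord0) *
    \prod_(j < n | j != i) dform2 eta x (u (inord j.*2.+1)) (u (inord j.*2.+2)).
  exists (c *: (u (inord i.*2.+2) *m A^T)); split=> [y|w wA _]; last first.
    by rewrite pairingZl pairing_mulmx trmxK wA pairing0r mulr0.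
  rewrite /term /upd (bigD1 i)//= eqxx (eq_sym ord0) d01 (eq_sym _ (inord i.*2.+1)) d12.
  rewrite (eq_bigr (fun j : 'I_n => dform2 eta x (u (inord j.*2.+1)) (u (inord j.*2.+2)))).
    by rewrite pairingZl pairing_mulmx trmxK /dform2 [pairing (y *m _) _]pairingC /c mulrCA mulrC.
  by move=> j ji; rewrite d11// (eq_sym _ (inord i.*2.+1)) d12.
- pose c := pairing e (u ord0) *
    \prod_(j < n | j != i) dform2 eta x (u (inord j.*2.+1)) (u (inord j.*2.+2)).
  exists (c *: (u (inord i.*2.+1) *m A)); split=> [y|w wA _]; last first.
    by rewrite pairingZl pairing_mulmx AT// pairing0r mulr0.
  rewrite /term /upd (bigD1 i)//= eqxx (eq_sym ord0) d02 d12.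
  rewrite (eq_bigr (fun j : 'I_n => dform2 eta x (u (inord j.*2.+1)) (u (inord j.*2.+2)))).
    by rewrite pairingZl /dform2 /c mulrCA mulrC.
  by move=> j ji; rewrite d22// d12.
Qed.

Lemma alternating_sum (v : 'I_N -> 'rV[R]_N) i j : i != j -> v i = v j ->
  \sum_(s : 'S_N) (-1) ^+ s * term (fun q => v (s q)) = 0.
Proof.
move=> ij vij; set S := \sum_s _; suff : S = - S.
  by move/eqP; rewrite -addr_eq0 -mulr2n mulrn_eq0 => /eqP.
rewrite {1}/S (reindex_inj (mulIg (tperm i j))) /= -sumrN.
apply: eq_bigr => s _; rewrite odd_permM odd_tperm ij addbT signrN mulNr.
congr (- (_ * term _)); apply/funext => q; rewrite permM.
by case: tpermP => [->|->|//].
Qed.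

(** If w is nonzero in the common kernel, some nontrivial combination of the arguments lies in that
    kernel. It lets one argument be traded for the others, and an alternating sum with a repeated
    argument is zero. *)
Lemma contact_volume_nondegenerate v : contact_volume eta x v != 0 ->
  forall w, w *m A = 0 -> pairing e w = 0 -> w = 0.
Proof.
move=> vol w wA we; apply/eqP; apply: contraNT vol => w0.
rewrite /contact_volume mulf_eq0; apply/orP; right; apply/eqP.
rewrite -/(term _).
(* If the [v i] form a basis, [c] holds the coordinates of [w]; otherwise it is a linear relation
   among them, and the combination is 0. *)
have [c [c0 cwA cwe]] : exists c : 'rV[R]_N, [/\ c != 0,
    (c *m \matrix_i v i) *m A = 0 & pairing e (c *m \matrix_i v i) = 0].
  have [uV|] := boolP ((\matrix_i v i) \in unitmx).
    exists (w *m invmx (\matrix_i v i)); rewrite mulmxKV//; split=> //.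
    by apply: contra w0 => /eqP E; rewrite -(mulmxKV uV w) E mul0mx.
  rewrite unitmxE unitfE negbK => /det0P[c c0 cV].
  by exists c; rewrite cV mul0mx pairing0r.
have [j cj] : exists j, c 0 j != 0.
  apply/existsP; apply: contraNT c0; rewrite negb_exists => /forallP c0.
  by apply/eqP/rowP => j; rewrite mxE; apply/eqP; rewrite -[_ == _]negbK.
apply: (mulfI cj); rewrite mulr0 mulr_sumr.
(* Under the permutation [s], the argument [v j] occupies slot s^-1 j. The combination vanishes in
   that slot, so [v j] times [c 0 j] may be replaced there by minus the rest of the combination. *)
have E (s : 'S_N) : c 0 j * ((-1) ^+ s * term (fun q => v (s q))) =
    - \sum_(i | i != j) c 0 i * ((-1) ^+ s * term (fun q => upd v j (v i) (s q))).
  have updE y : (fun q => upd v j y (s q)) = upd (fun q => v (s q)) ((s^-1)%g j) y.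
    apply/funext => q; rewrite /upd; congr (if _ then _ else _).
    by apply/eqP/eqP => [<-|->]; rewrite ?permK ?permKV.
  have [a [ha hw]] := term_linear (fun q => v (s q)) ((s^-1)%g j).
  have vE : term (fun q => v (s q)) = pairing a (v j).
    rewrite -ha -updE; congr term; apply/funext => q; rewrite /upd.
    by case: eqP => [->|].
  have := hw _ cwA cwe; rewrite mulmx_sum_row pairing_sumr (bigD1 j)//= rowK pairingZr.
  move/eqP; rewrite addr_eq0 => /eqP H.
  rewrite mulrCA vE H mulrN mulr_sumr; congr (- _); apply: eq_bigr => i _.
  by rewrite updE ha rowK pairingZr mulrCA.
rewrite (eq_bigr _ (fun s _ => E s)) sumrN exchange_big /= big1 ?oppr0// => i ij.
rewrite -mulr_sumr (@alternating_sum (upd v j (v i)) i j)// ?mulr0//.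
by rewrite /upd eqxx (negbTE ij).
Qed.

End ContactVolume.

Lemma dform_tr (R : realType) (m : nat) (M : manifold R m) (eta : oneform M) x :
  (dform eta x)^T = - dform eta x.
Proof. by apply/matrixP => i j; rewrite !mxE opprB. Qed.

Lemma dform2C (R : realType) (m : nat) (M : manifold R m) (eta : oneform M) x u v :
  dform2 eta x u v = - dform2 eta x v u.
Proof. by rewrite /dform2 pairing_mulmx dform_tr mulmxN pairingC pairingNl. Qed.

(** The kernel of X = (coker A | coker B) is the intersection of the two row spaces. A functional
    vanishing on it factors through X, and the two blocks of the factorisation are the summands. *)
Lemma rowspace_intersection_annihilator (R : realType) (m p q : nat)
    (A : 'M[R]_(p, m)) (B : 'M[R]_(q, m)) (f : 'rV[R]_m) :
  (forall t : 'rV[R]_m, (t <= A)%MS -> (t <= B)%MS -> pairing f t = 0) ->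
  exists a b, [/\ f = a + b, forall t : 'rV[R]_m, (t <= A)%MS -> pairing a t = 0 &
    forall t : 'rV[R]_m, (t <= B)%MS -> pairing b t = 0].
Proof.
move=> fAB; set X := row_mx (cokermx A) (cokermx B).
have : (f <= X^T)%MS.
  rewrite submxE; apply/eqP/trmx_inj; rewrite trmx_mul trmx0.
  apply/row_matrixP => i; rewrite row0 row_mul; set t := row i _.
  have : t *m X = 0.
    rewrite /t -row_mul; apply/rowP => j.
    by rewrite -[X in _ *m X]trmxK -trmx_mul mulmx_coker trmx0 !mxE.
  rewrite /X mul_mx_row -[0]row_mx0 => /eq_row_mx[tA tB].
  have := fAB t; rewrite !submxE tA tB eqxx => /(_ isT isT).
  by rewrite pairingC /pairing => H; apply/rowP => j; rewrite !ord1 [RHS]mxE.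
move=> /submxP[h ->]; rewrite -[h]hsubmxK tr_row_mx mul_row_col.
exists (lsubmx h *m (cokermx A)^T), (rsubmx h *m (cokermx B)^T); split=> // t.
  by rewrite submxE => /eqP tA; rewrite pairing_mulmx trmxK tA pairing0r.
by rewrite submxE => /eqP tB; rewrite pairing_mulmx trmxK tB pairing0r.
Qed.

Lemma mulmx_tr_pairing (R : realType) (m p : nat) (X : 'M[R]_(p, m)) u j :
  (u *m X^T) 0 j = pairing u (row j X).
Proof. by rewrite /pairing !mxE; apply: eq_bigr => i _; rewrite !mxE. Qed.

(** * Sharp maps and Legendrian subspaces at a point *)

Section ContactPoint.
Variables (R : realType) (n : nat) (M : manifold R n.*2.+1) (eta : oneform M) (x : M).
Hypothesis ctc : contact_form eta.
Local Notation e := (eta x).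
Local Notation A := (dform eta x).
Implicit Types D : set 'rV[R]_n.*2.+1.

Lemma contact_nondegenerate w : w *m A = 0 -> pairing e w = 0 -> w = 0.
Proof. by have [_ /(_ x)[v /contact_volume_nondegenerate]] := ctc; exact. Qed.

(** A skew matrix of odd size is singular. A kernel vector cannot also lie in ker eta, so it can be
    rescaled to eta = 1. *)
Lemma reeb_exists : exists r : 'rV[R]_n.*2.+1, r *m A = 0 /\ pairing e r = 1.
Proof.
have : \det A = 0.
  apply/eqP; rewrite -[_ == 0](mulrn_eq0 _ 2) mulr2n addr_eq0.
  by rewrite -{1}det_tr dform_tr -scaleN1r detZ -signr_odd /= odd_double expr1 mulN1r.
move=> /eqP/det0P[r r0 rA]; have er : pairing e r != 0.
  by apply: contra r0 => /eqP er; apply/eqP; exact: contact_nondegenerate.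
by exists ((pairing e r)^-1 *: r); rewrite -scalemxAl rA scaler0 pairingZr mulVf.
Qed.

Lemma mulmx_tr_self v : v *m (e^T *m e) = pairing e v *: e.
Proof. by rewrite mulmxA [v *m _]mx11_scalar mul_scalar_mx pairingC. Qed.

Lemma mulmx_flat v : v *m flat_mx eta x = v *m A + pairing e v *: e.
Proof. by rewrite mulmxDr mulmx_tr_self. Qed.

Lemma mulmx_dform_reeb r v : r *m A = 0 -> pairing (v *m A) r = 0.
Proof. by move=> rA; rewrite pairing_mulmx dform_tr mulmxN rA oppr0 pairing0r. Qed.

Lemma flat_unit : flat_mx eta x \in unitmx.
Proof.
have [r [rA er]] := reeb_exists.
rewrite unitmxE unitfE; apply/negP => /det0P[v /negP v0].
rewrite mulmx_flat => h.
have ev : pairing e v = 0.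
  have := congr1 (fun z => pairing z r) h; rewrite pairingDl mulmx_dform_reeb// add0r.
  by rewrite pairingZl er mulr1 pairing0l.
apply: v0; apply/eqP; apply: contact_nondegenerate => //.
by move: h; rewrite ev scale0r addr0.
Qed.

Lemma sharpK a : sharp eta x a *m A + pairing e (sharp eta x a) *: e = a.
Proof. by rewrite -mulmx_flat /sharp mulmxKV// flat_unit. Qed.

Lemma eta_sharp r a : r *m A = 0 -> pairing e r = 1 ->
  pairing e (sharp eta x a) = pairing a r.
Proof.
move=> rA er; rewrite -{2}(sharpK a) pairingDl mulmx_dform_reeb// add0r.
by rewrite pairingZl er mulr1.
Qed.

(** Reconciles the definition Lambda(a, -) with the formula sharp(a) - a(R) R. Both sides are
    compared after applying the transpose of [flat_mx], in which d eta changes sign. *)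
Lemma sharp_LambdaE r a : r *m A = 0 -> pairing e r = 1 ->
  sharp_Lambda eta x a = sharp eta x a - pairing a r *: r.
Proof.
move=> rA er; set s := sharp eta x a; have se := eta_sharp a rA er.
have E : sharp_Lambda eta x a = - (s *m A) *m (invmx (flat_mx eta x))^T.
  apply/rowP => i; rewrite mxE /Lambda /dform2 -/s mulNmx [RHS]mxE; congr (- _).
  by rewrite /sharp /pairing trmx_mul mulmxA trmx_delta -colE mxE.
have fT : (flat_mx eta x)^T = - A + e^T *m e.
  by rewrite /flat_mx linearD /= dform_tr trmx_mul trmxK.
have uT : (flat_mx eta x)^T \in unitmx by rewrite unitmx_tr flat_unit.
rewrite E trmx_inv -[RHS](mulmxK uT); congr (_ *m _).
rewrite fT mulmxDr !mulmxBl !mulmxN -!scalemxAl rA scaler0 oppr0 subr0 -[LHS]addr0; congr (_ + _).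
by rewrite !mulmx_tr_self se er scale1r subrr.
Qed.

Lemma sharp_Lambda_dform r a : r *m A = 0 -> pairing e r = 1 ->
  sharp_Lambda eta x a *m A = a - pairing a r *: e.
Proof.
move=> rA er; rewrite (sharp_LambdaE _ rA er) mulmxBl -scalemxAl rA scaler0 subr0.
by rewrite -{2}(sharpK a) (eta_sharp a rA er) addrK.
Qed.

Lemma eta_sharp_Lambda a : pairing e (sharp_Lambda eta x a) = 0.
Proof.
have [r [rA er]] := reeb_exists.
rewrite (sharp_LambdaE _ rA er) pairingDr (eta_sharp a rA er).
by rewrite -scaleNr pairingZr er mulr1 subrr.
Qed.

Lemma contact_complement_dform D v t : contact_complement eta x D v -> D t ->
  pairing e t = 0 -> dform2 eta x v t = 0.
Proof.
have [r [rA er]] := reeb_exists; move=> [a aD <-] Dt et.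
rewrite /dform2 (sharp_Lambda_dform _ rA er) pairingDl aD// -scaleNr pairingZl.
by rewrite et mulr0 addr0.
Qed.

Lemma eta_contact_complement D v : contact_complement eta x D v -> pairing e v = 0.
Proof. by move=> [a _ <-]; exact: eta_sharp_Lambda. Qed.

(** The witness is the covector i_v d eta: it annihilates D by hypothesis, and sharp_Lambda sends it
    back to v since eta(v) = 0. *)
Lemma mem_contact_complement D v : pairing e v = 0 ->
  (forall t, D t -> dform2 eta x v t = 0) -> contact_complement eta x D v.
Proof.
move=> ev Dv; have [r [rA er]] := reeb_exists.
exists (v *m A) => //; rewrite (sharp_LambdaE _ rA er) mulmx_dform_reeb// scale0r subr0.
rewrite /sharp -[RHS](mulmxK flat_unit); congr (_ *m _).
by rewrite mulmx_flat ev scale0r addr0.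
Qed.

(** Legendrian means Lagrangian in the symplectic space (ker eta, d eta): isotropic and equal to its
    own symplectic complement. *)
Lemma legendrianP D : contact_complement eta x D = D <->
  [/\ forall t, D t -> pairing e t = 0, forall t t', D t -> D t' -> dform2 eta x t t' = 0 &
    forall v, pairing e v = 0 -> (forall t, D t -> dform2 eta x v t = 0) -> D v].
Proof.
split=> [DE|[D0 DD Dmax]].
  have D0 t : D t -> pairing e t = 0 by rewrite -DE => /eta_contact_complement.
  split=> // [t t' Dt Dt'|v ev Dv]; last by rewrite -DE; exact: mem_contact_complement.
  by apply: contact_complement_dform (Dt') (D0 _ Dt'); rewrite DE.
apply/seteqP; split=> v Dv; last first.
  by apply: mem_contact_complement; [exact: D0|move=> t Dt; exact: DD].
apply: Dmax; first exact: eta_contact_complement Dv.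
by move=> t Dt; apply: contact_complement_dform (Dv) Dt (D0 _ Dt).
Qed.

(** By [legendrianP] the row space of S is cut out by eta and the forms i_t d eta with t in S. These
    span rank S + 1 dimensions: eta is told apart by the Reeb vector, and d eta is injective on S.
    Hence rank S = (2n + 1) - (rank S + 1). *)
Lemma legendrian_rank p (S : 'M[R]_(p, n.*2.+1)) :
  contact_complement eta x (range (fun v : 'rV[R]_p => v *m S)) =
    range (fun v : 'rV[R]_p => v *m S) -> \rank S = n.
Proof.
move=> /legendrianP[S0 SS Smax].
have [r [rA er]] := reeb_exists.
have rowS i : range (fun v : 'rV[R]_p => v *m S) (row i S).
  by exists (delta_mx 0 i) => //; rewrite rowE.
pose X := col_mx e (S *m A).
have SX : (S :=: kermx X^T)%MS.
  apply/eqmxP/andP; split; last first.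
    apply/rV_subP => v; rewrite sub_kermx tr_col_mx mul_mx_row -[0]row_mx0.
    move=> /eqP/eq_row_mx[ve vA].
    have [|_ [u _ <-]|u _ <-] := Smax v; last exact: submxMl.
      by rewrite pairingC /pairing ve mxE.
    rewrite dform2C /dform2 -mulmxA pairing_mulmx.
    by rewrite vA pairing0r oppr0.
  apply/row_subP => i; rewrite sub_kermx tr_col_mx mul_mx_row -[0]row_mx0.
  apply/eqP; congr row_mx; apply/rowP => j.
    by rewrite !ord1 [RHS]mxE; have := S0 _ (rowS i); rewrite pairingC.
  rewrite mulmx_tr_pairing [RHS]mxE row_mul pairingC.
  exact: SS (rowS j) (rowS i).
have rX : \rank X = (\rank S).+1.
  rewrite -addsmxE.
  have cap0 : (e :&: (S *m A) = 0)%MS.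
    apply/eqP; rewrite -submx0; apply/rV_subP => v; rewrite sub_capmx submx0.
    move=> /andP[/sub_rVP[c ->] /submxP[h hE]].
    have := congr1 (fun z => pairing z r) hE; rewrite pairingZl er mulr1 mulmxA.
    by rewrite mulmx_dform_reeb// => ->; rewrite scale0r.
  have := mxrank_sum_cap e (S *m A); rewrite cap0 mxrank0 addn0 => ->.
  have -> : \rank e = 1%N.
    rewrite rank_rV; case: eqP => // e0; have := er; rewrite e0 pairing0l => /esym/eqP.
    by rewrite oner_eq0.
  rewrite add1n; congr _.+1; rewrite -(mxrank_mul_ker S A).
  have -> : (S :&: kermx A = 0)%MS.
    apply/eqP; rewrite -submx0; apply/rV_subP => v; rewrite sub_capmx submx0.
    move=> /andP[/submxP[h ->]]; rewrite sub_kermx => /eqP hA.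
    by apply/eqP; apply: contact_nondegenerate => //; apply: S0; exists h.
  by rewrite mxrank0 addn0.
have := mxrank_ker X^T; rewrite -SX mxrank_tr rX; have := rank_leq_col X; rewrite rX.
lia.
Qed.

End ContactPoint.

(** * Reduction of a Legendrian subspace by TN^perp *)

Section Reduction.
Variables (R : realType) (n k d l : nat).
Variables (M : manifold R n.*2.+1) (eta : oneform M) (x : M).
Variables (Q : manifold R k.*2.+1) (etat : oneform Q) (y : Q).
Hypothesis ctc : contact_form eta.
Hypothesis ctct : contact_form etat.
(** Acting on row vectors, [i], [p] and [s] stand for the differentials of the inclusion of N, of
    the projection, and of the inclusion of L. *)
Variables (i : 'M[R]_(d, n.*2.+1)) (p : 'M[R]_(d, k.*2.+1)) (s : 'M[R]_(l, n.*2.+1)).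
Hypothesis pull : forall u, pairing (etat y) (u *m p) = pairing (eta x) (u *m i).
Hypothesis dpull : forall u w,
  dform2 etat y (u *m p) (w *m p) = dform2 eta x (u *m i) (w *m i).
Hypothesis psurj : forall v, exists u : 'rV[R]_d, v = u *m p.
Let TN := range (fun u : 'rV[R]_d => u *m i).
Let TL := range (fun u : 'rV[R]_l => u *m s).
Hypothesis coiso : contact_complement eta x TN `<=` TN.
Hypothesis nonhor : exists u : 'rV[R]_d, pairing (eta x) (u *m i) != 0.
Hypothesis ker : forall u, contact_complement eta x TN (u *m i) -> u *m p = 0.
Hypothesis leg : contact_complement eta x TL = TL.

(* The pulled-back forms vanish on TN^perp, which forces the Reeb vector to be
   tangent to N. *)
Lemma annihilator_reeb r a : r *m dform eta x = 0 -> pairing (eta x) r = 1 ->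
  annihilator TN a -> pairing a r = 0.
Proof.
move=> rA er aN; have [u u0] := nonhor.
have Nv : contact_complement eta x TN (sharp_Lambda eta x a) by exists a.
have [w _ wE] := coiso Nv.
(* Here [w *m i] is sharp_Lambda(a), which [p] kills; on the other hand the same number is -a(R)
   eta(u), and eta(u) is nonzero. *)
have : dform2 eta x (w *m i) (u *m i) = 0.
  by rewrite -dpull ker ?wE// /dform2 mul0mx pairing0l.
rewrite /dform2 wE (sharp_Lambda_dform ctc _ rA er) pairingDl aN ?add0r; last by exists u.
rewrite -scaleNr pairingZl => /eqP; rewrite mulf_eq0 (negbTE u0) orbF oppr_eq0.
by move/eqP.
Qed.

(** Isotropy is pulled back. For maximality, lift v to u in TN: i_u d eta kills TN /\ TL, so it is a
    + b with a annihilating TL and b annihilating TN. As b(R) = 0, w = sharp_Lambda(b) satisfies i_w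
    d eta = b exactly. Then u - w still projects to v, and i_(u-w) d eta = a kills TL, which puts u
    - w in TL. *)
Lemma reduction_legendrian :
  let D := [set v | exists2 u, TL (u *m i) & v = u *m p] in
  contact_complement etat y D = D.
Proof.
move=> D; have [L0 LL Lmax] := (legendrianP x ctc TL).1 leg.
apply/(legendrianP y ctct); split.
- by move=> _ [u Lu ->]; rewrite pull; exact: L0.
- by move=> _ _ [u Lu ->] [w Lw ->]; rewrite dpull; exact: LL.
- move=> v ev Dv; have [u uE] := psurj v; rewrite uE pull in ev *.
  have uv : forall t : 'rV[R]_n.*2.+1, (t <= s)%MS -> (t <= i)%MS ->
      pairing (u *m i *m dform eta x) t = 0.
    move=> t /submxP[c tE] /submxP[b tE']; rewrite tE'.
    have := dpull u b; rewrite /dform2 => <-; rewrite -/(dform2 etat y _ _) -uE.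
    by apply: Dv; exists b => //; exists c; rewrite -?tE.
  have [a [b [fE aL bN]]] := rowspace_intersection_annihilator uv.
  have [r [rA er]] := reeb_exists x ctc.
  have bN' : annihilator TN b by move=> _ [w _ <-]; apply: bN; exact: submxMl.
  have br := annihilator_reeb rA er bN'.
  pose w := sharp_Lambda eta x b.
  have Nw : contact_complement eta x TN w by exists b.
  have [w' _ wE] := coiso Nw.
  have ew := eta_contact_complement ctc Nw.
  have wA : w *m dform eta x = b.
    by rewrite /w (sharp_Lambda_dform ctc _ rA er) br scale0r subr0.
  exists (u - w'); last first.
    by rewrite mulmxBl (@ker w') ?subr0// wE.
  apply: Lmax; rewrite mulmxBl wE.
    by rewrite -scaleN1r pairingDr ev pairingZr ew mulr0 addr0.
  move=> _ [c _ <-]; rewrite /dform2 mulmxBl fE wA addrK; apply: aL; exact: submxMl.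
Qed.

End Reduction.

(** * Pullback of the exterior derivative, leaves *)

Lemma smooth_at_coord (R : realType) (m p : nat) (f : 'rV[R]_m -> 'rV[R]_p) x j :
  smooth_at f x -> smooth_at (fun u => f u 0 j) x.
Proof.
move=> [A [oA Ax CA]]; exists A; split=> // k.
exact: ((Cn_mxP k f oA).1 (CA k) 0 j).
Qed.

Lemma derive_coord_near (R : realType) (m p : nat) (f : 'rV[R]_m -> 'rV[R]_p) x v j :
  smooth_at f x -> \forall u \near x, 'D_v f u 0 j = 'D_v (fun u => f u 0 j) u.
Proof.
move=> /smooth_at_near; apply: filterS => u /smooth_at_diff df.
by rewrite derive_mx ?mxE//; exact: diff_derivable.
Qed.

Lemma Schwarz_coord (R : realType) (m p : nat) (f : 'rV[R]_m -> 'rV[R]_p) x v w j :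
  smooth_at f x ->
  'D_w (fun u => 'D_v f u 0 j) x = 'D_v (fun u => 'D_w f u 0 j) x.
Proof.
move=> sf; apply: etrans (near_eq_derive _ (derive_coord_near v j sf)) _.
apply: etrans _ (esym (near_eq_derive _ (derive_coord_near w j sf))).
have sfj := smooth_at_coord j sf; apply: Schwarz.
- by apply: filterS (smooth_at_near sfj) => y /smooth_at_diff.
- exact: smooth_at_diff (smooth_at_derive _ sfj).
- exact: smooth_at_diff (smooth_at_derive _ sfj).
Qed.

Lemma derive_sum_mul (R : realType) (m p : nat) (f g : 'I_p -> 'rV[R]_m -> R) x w :
  (forall j, differentiable (f j) x) -> (forall j, differentiable (g j) x) ->
  'D_w (fun u => \sum_j f j u * g j u) x =
  \sum_j (f j x * 'D_w (g j) x + g j x * 'D_w (f j) x).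
Proof.
move=> df dg; have -> : (fun u => \sum_j f j u * g j u) = \sum_j (f j * g j).
  by apply/funext => u; rewrite fct_sumE.
have dfg j : derivable (f j * g j) x w.
  by apply: derivableM; exact: diff_derivable.
rewrite derive_sum//; apply: eq_bigr => j _.
by rewrite deriveM//; exact: diff_derivable.
Qed.

(** The terms [a j * s j], which will carry the second derivatives, cancel; the rest regroups as the
    antisymmetrised coefficients of d alpha. *)
Lemma antisymmetrized_sum (R : realType) (m : nat) (a s x y : 'I_m -> R) (c : 'I_m -> 'I_m -> R) :
  \sum_j (a j * s j + y j * \sum_i x i * c i j) -
  \sum_j (a j * s j + x j * \sum_i y i * c i j) =
  \sum_j (\sum_i x i * (c i j - c j i)) * y j.
Proof.
rewrite -sumrB; under eq_bigr => j _ do rewrite opprD addrACA subrr add0r.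
rewrite sumrB.
have -> : \sum_j x j * (\sum_i y i * c i j) = \sum_j y j * (\sum_i x i * c j i).
  under eq_bigr => j _ do rewrite mulr_sumr.
  rewrite exchange_big /=; apply: eq_bigr => i _; rewrite mulr_sumr.
  by apply: eq_bigr => j _; rewrite mulrCA.
rewrite -sumrB; apply: eq_bigr => j _; rewrite -mulrBr mulrC -sumrB; congr (_ * _).
by apply: eq_bigr => i _; rewrite mulrBr.
Qed.

(** The formula d alpha (w, v) = w(alpha(v)) - v(alpha(w)) for constant, hence commuting, fields,
    applied to the pullback of [al] by [phi]. The second derivatives of [phi] cancel by symmetry. *)
Lemma pullback_derivative (R : realType) (d m : nat) (phi : 'rV[R]_d -> 'rV[R]_m)
    (al : 'rV[R]_m -> 'rV[R]_m) u v w :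
  smooth_at phi u -> differentiable al (phi u) ->
  'D_w (fun y => pairing (al (phi y)) ('D_v phi y)) u -
  'D_v (fun y => pairing (al (phi y)) ('D_w phi y)) u =
  pairing ('D_w phi u *m
    \matrix_(i, j) ('D_(delta_mx 0 i) al (phi u) 0 j - 'D_(delta_mx 0 j) al (phi u) 0 i))
    ('D_v phi u).
Proof.
move=> sphi dal; have dphi := smooth_at_diff sphi.
have dalphi : differentiable (al \o phi) u by exact: differentiable_comp.
have D1 v' w' : 'D_w' (fun y => pairing (al (phi y)) ('D_v' phi y)) u =
    \sum_j (al (phi u) 0 j * 'D_w' (fun y => 'D_v' phi y 0 j) u +
      'D_v' phi u 0 j * 'D_w' (fun y => al (phi y) 0 j) u).
  have -> : (fun y => pairing (al (phi y)) ('D_v' phi y)) =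
      (fun y => \sum_j (fun y => al (phi y) 0 j) y * (fun y => 'D_v' phi y 0 j) y).
    by apply/funext => y; rewrite pairingE.
  rewrite (derive_sum_mul (f := fun j y => al (phi y) 0 j) (g := fun j y => 'D_v' phi y 0 j))// => j.
    by apply: (@differentiable_comp _ _ _ _ (al \o phi) (fun M : 'rV[R]_m => M 0 j)) => //; exact: differentiable_coord.
  exact: smooth_at_diff (smooth_at_coord j (smooth_at_derive v' sphi)).
have D2 w' j : 'D_w' (fun y => al (phi y) 0 j) u =
    \sum_i 'D_w' phi u 0 i * 'D_(delta_mx 0 i) al (phi u) 0 j.
  have -> : 'D_w' (fun y => al (phi y) 0 j) u = ('D_w' (al \o phi) u) 0 j.
    by rewrite derive_mx ?mxE//; exact: diff_derivable.
  rewrite derive_comp_rV// (derive_rV _ dal) summxE.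
  by apply: eq_bigr => i _; rewrite mxE.
pose S j := 'D_w (fun y => 'D_v phi y 0 j) u.
have Sj j : 'D_v (fun y => 'D_w phi y 0 j) u = S j by exact: Schwarz_coord.
have Ev : 'D_w (fun y => pairing (al (phi y)) ('D_v phi y)) u = \sum_j (al (phi u) 0 j * S j +
    'D_v phi u 0 j * \sum_i 'D_w phi u 0 i * 'D_(delta_mx 0 i) al (phi u) 0 j).
  by apply: etrans (D1 v w) _; apply: eq_bigr => j _; congr (_ + _ * _); exact: D2.
have Ew : 'D_v (fun y => pairing (al (phi y)) ('D_w phi y)) u = \sum_j (al (phi u) 0 j * S j +
    'D_w phi u 0 j * \sum_i 'D_v phi u 0 i * 'D_(delta_mx 0 i) al (phi u) 0 j).
  apply: etrans (D1 w v) _; apply: eq_bigr => j _.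
  exact: (congr2 (fun a b => al (phi u) 0 j * a + 'D_w phi u 0 j * b) (Sj j) (D2 v j)).
apply: etrans (congr2 (fun a b => a - b) Ev Ew) _.
apply: etrans (antisymmetrized_sum _ _ _ _ _) _.
rewrite pairingE; apply: eq_bigr => j _; rewrite mxE; congr (_ * _).
by apply: eq_bigr => i _; congr (_ * _); rewrite mxE.
Qed.

Lemma form_in_chart_diff (R : realType) (m : nat) (M : manifold R m) (eta : oneform M) x :
  smooth_form eta -> differentiable (form_in_chart eta x) (chart M x x).
Proof.
move=> /(_ x)/smooth_onP-/(_ (@codom_open _ _ M x)) => h; apply: smooth_at_diff; apply: h.
by exists x => //; exact: dom_self.
Qed.

(** The right side involves only eta and the differential of f at the nearby point, paired with a
    vector independent of f. A pointwise equality of pullbacks thus becomes an equality of functions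
    near [chart N x x], which can be differentiated. *)
Lemma form_in_chart_pullback (R : realType) (d m : nat) (N : manifold R d)
    (M : manifold R m) (f : N -> M) (eta : oneform M) x v :
  smooth_map f -> \forall u \near chart N x x,
  pairing (form_in_chart eta (f x) (in_charts f x u)) ('D_v (in_charts f x) u) =
  pairing (eta (f (chart_inv N x u)))
    (mdiff f (chart_inv N x u) (v *m 'J (loc x (chart_inv N x u) (@id N)) u)).
Proof.
move=> sf; have dx := dom_self x; have dfx := dom_self (f x).
have near1 := chart_image_nbhs dx (sf.1 x _ (near_chart dfx)).
apply: filterS2 (near_chart_inv dx) near1 => u [du uE] /=.
set x' := chart_inv N x u in du uE *; move=> dfx'.
have E : in_charts f x u = chart M (f x) (f x') by [].
have zE : chart_inv M (f x) (chart M (f x) (f x')) = f x' by rewrite chartK.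
rewrite /form_in_chart E zE pairing_mulmx trmxK mdiffE; congr pairing.
have sfu : smooth_at (in_charts f x) u by rewrite -uE; exact: smooth_map_loc.
rewrite (deriveE _ (smooth_at_diff sfu)) diffJ.
have JE : 'J (in_charts f x) u = 'J (loc x x' (@id N)) u *m mJ f x' *m
    'J (loc (f x') (f x) (@id M)) (chart M (f x') (f x')).
  by rewrite -uE; exact: smooth_map_mJ.
rewrite JE -!mulmxA; congr (_ *m (_ *m _)).
rewrite -[RHS]mulmx1; congr (_ *m _).
exact: (transition_jacobian (dom_self (f x')) dfx').
Qed.

Lemma pullback_dform (R : realType) (d m p : nat) (N : manifold R d)
    (M : manifold R m) (Q : manifold R p) (f : N -> M) (g : N -> Q)
    (eta : oneform M) (etat : oneform Q) :
  smooth_map f -> smooth_map g -> smooth_form eta -> smooth_form etat ->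
  (forall x v, pairing (etat (g x)) (mdiff g x v) = pairing (eta (f x)) (mdiff f x v)) ->
  forall x v w, dform2 etat (g x) (v *m mJ g x) (w *m mJ g x) =
    dform2 eta (f x) (v *m mJ f x) (w *m mJ f x).
Proof.
move=> sf sg se set' pull x v w; have dx := dom_self x; set u := chart N x x.
have H (a : nat) (A : manifold R a) (h : N -> A) (b : oneform A) : smooth_map h -> smooth_form b ->
    dform2 b (h x) (v *m mJ h x) (w *m mJ h x) =
    'D_v (fun y => pairing (form_in_chart b (h x) (in_charts h x y)) ('D_w (in_charts h x) y)) u -
    'D_w (fun y => pairing (form_in_chart b (h x) (in_charts h x y)) ('D_v (in_charts h x) y)) u.
  move=> sh sb; have sl : smooth_at (in_charts h x) u by apply: smooth_map_loc => //; exact: dom_self.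
  have hu : in_charts h x u = chart A (h x) (h x) by exact: loc_chart.
  rewrite pullback_derivative//; last by rewrite hu; exact: form_in_chart_diff.
  rewrite hu /dform2; congr (pairing (_ *m _) _); apply: etrans (esym (diffJ _ _ _)) _;
    exact: esym (deriveE _ (smooth_at_diff sl)).
rewrite !H//; congr (_ - _); apply: near_eq_derive.
  apply: filterS2 (form_in_chart_pullback eta x w sf) (form_in_chart_pullback etat x w sg).
  by move=> y -> ->; rewrite pull.
apply: filterS2 (form_in_chart_pullback eta x v sf) (form_in_chart_pullback etat x v sg).
by move=> y -> ->; rewrite pull.
Qed.

Lemma mJ_const (R : realType) (m p : nat) (M : manifold R m) (N : manifold R p)
    (f : M -> N) x : (forall y z, f y = f z) -> mJ f x = 0.
Proof.
move=> fc; have E : in_charts f x = cst (chart N (f x) (f x)).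
  by apply/funext => u; rewrite /in_charts /= (fc _ x).
apply: mulmx_ext => v; rewrite mulmx0; apply: etrans (esym (diffJ _ _ _)) _.
by rewrite E diff_cst.
Qed.

(** Any two points of a connected integral manifold lie in one leaf, so [proj] is constant on it;
    its tangent space is D. One exists through x because x is in the leaf of itself. *)
Lemma characteristic_ker (R : realType) (m k : nat) (N : manifold R m)
    (D : N -> set 'rV[R]_m) (Q : manifold R k) (proj : N -> Q) :
  leaf_space D proj -> forall x v, D x v -> v *m mJ proj x = 0.
Proof.
move=> [[sp _] _ leaf] x v Dv.
have [r [P [j [imj injj conn tj [[p _ jp] _]]]]] := (leaf x x).1 erefl.
have const (a b : P) : (proj \o j) a = (proj \o j) b.
  by apply/leaf; exists r, P, j; split=> //.
have [_ mJE] := smooth_map_comp imj.1 sp.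
have [w _ <-] : tangent j p v by rewrite tj jp.
by rewrite -jp mdiffE -mulmxA -mJE (mJ_const _ const) mulmx0.
Qed.

(** * Constant rank *)

Lemma continuous_near (T U : topologicalType) (f : T -> U) x (P : set U) :
  {for x, continuous f} -> (\forall z \near f x, P z) -> \forall y \near x, P (f y).
Proof. by move=> cf; exact: cf. Qed.

Lemma rank_factor (F : fieldType) (r m k : nat) (A : 'M[F]_(r, m)) : \rank A = k ->
  exists (E : 'M[F]_(k, r)) (P : 'M[F]_(m, k)), E *m A *m P = 1%:M.
Proof.
move=> rA; have /row_fullP[E EC] := col_base_full A.
have /row_freeP[P PR] := row_base_free A.
case: k / rA; exists E, P; rewrite -[X in _ *m X *m _]mulmx_base mulmxA EC mul1mx.
exact: PR.
Qed.

(** If [P] does not lower the rank of [A], it is injective on the row space of [A]. *)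
Lemma rank_mul_ker (F : fieldType) (r m k : nat) (A : 'M[F]_(r, m)) (P : 'M[F]_(m, k))
    (w : 'rV[F]_r) : (\rank A <= \rank (A *m P))%N -> w *m A *m P = 0 -> w *m A = 0.
Proof.
move=> le wAP; have := mxrank_mul_ker A P.
have -> : \rank (A *m P) = \rank A by apply/eqP; rewrite eqn_leq le mxrankM_maxl.
rewrite -[RHS]addn0 => /addnI/eqP; rewrite mxrank_eq0 => /eqP cap0.
apply/eqP; rewrite -submx0 -cap0 sub_capmx submxMl sub_kermx wAP.
by rewrite eqxx.
Qed.

Lemma jacobian_add (R : realType) (m p : nat) (f g : 'rV[R]_m -> 'rV[R]_p) x :
  differentiable f x -> differentiable g x ->
  'J (fun u => f u + g u) x = 'J f x + 'J g x.
Proof.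
move=> df dg; apply: mulmx_ext => v; apply: etrans (esym (diffJ _ _ _)) _.
have E := @diffD _ _ _ f g x df dg; apply: etrans (congr1 (fun F => F v) E) _.
apply: etrans (congr2 +%R (diffJ f x v) (diffJ g x v)) _.
by rewrite mulmxDr.
Qed.

Lemma jacobian_mul_cst (R : realType) (m p q : nat) (f : 'rV[R]_m -> 'rV[R]_p)
    (A : 'M[R]_(p, q)) x :
  differentiable f x -> 'J (fun u => f u *m A) x = 'J f x *m A.
Proof.
move=> df; have -> : (fun u => f u *m A) = (fun v => v *m A) \o f by [].
rewrite jacobian_comp//; last exact: differentiable_mulmx.
congr (_ *m _); apply: mulmx_ext => v; apply: etrans (esym (diffJ _ _ _)) _.
exact: diff_mulmx.
Qed.

Lemma jacobian_cst (R : realType) (m p : nat) (c : 'rV[R]_p) (x : 'rV[R]_m) :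
  'J (fun=> c) x = 0.
Proof.
apply: mulmx_ext => v; rewrite mulmx0; apply: etrans (esym (diffJ _ _ _)) _.
by rewrite -[X in 'd X x]/(cst c) diff_cst.
Qed.

(** The part of the constant rank theorem that is needed: near u0 every value of h is taken on a
    k-dimensional affine slice on which h is immersive. A change of variable [Phi] makes h depend
    only on k linear coordinates, and the slice meets every level of these. *)
Lemma constant_rank_slice (R : realType) (r m k : nat) (h : 'rV[R]_r -> 'rV[R]_m) u0
    (V : set 'rV[R]_r) :
  smooth_at h u0 -> (\forall u \near u0, \rank ('J h u) = k) -> nbhs u0 V ->
  exists (E : 'M[R]_(k, r)) (e : R), [/\ 0 < e,
    forall w : 'rV[R]_k, `|w| < e ->
      V (u0 + w *m E) /\ \rank (E *m 'J h (u0 + w *m E)) = k &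
    \forall u \near u0, exists2 w : 'rV[R]_k, `|w| < e & h (u0 + w *m E) = h u].
Proof.
move=> sh rh nV; have rh0 : \rank ('J h u0) = k := nbhs_singleton rh.
set J0 := 'J h u0 in rh0 *.
have [E [P EJP]] := rank_factor rh0.
pose K := J0 *m P; have EK : E *m K = 1%:M by rewrite /K mulmxA.
have sEJP : smooth_at (fun u => E *m 'J h u *m P) u0.
  have [A [oA Au0 CA]] := smooth_at_jacobian sh; exists A; split=> // n.
  by apply: Cn_mulmx => //; [apply: Cn_mulmx => //|]; exact: Cn_cst.
have unear : \forall u \near u0, E *m 'J h u *m P \in unitmx.
  by apply: smooth_at_unit_near => //; rewrite -/J0 EJP unitmx1.
have good : \forall u \near u0, [/\ V u, smooth_at h u, \rank ('J h u) = k &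
    E *m 'J h u *m P \in unitmx].
  apply: filterS2 (filterI nV (smooth_at_near sh)) (filterI rh unear).
  by move=> u [? ?] [].
have goodker u (w : 'rV[R]_r) : \rank ('J h u) = k -> E *m 'J h u *m P \in unitmx ->
    w *m 'J h u *m P = 0 -> w *m 'J h u = 0.
  move=> ru uu wP; apply: (@rank_mul_ker _ r m k ('J h u) P w _ wP).
  by rewrite ru -[X in (X <= _)%N](mxrank_unit uu) -mulmxA; exact: mxrankM_maxr.
(* h + [lin] is the remainder of h after its first-order expansion at u0, so [Phi] has derivative 1
   there. *)
pose lin u := - u *m J0 + (u0 *m J0 - h u0).
have slin u : smooth_at lin u /\ 'J lin u = - J0.
  have NE : (fun v : 'rV[R]_r => - v) = (fun v => v *m (- 1%:M)).
    by apply/funext => v; rewrite mulmxN mulmx1.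
  have sN : smooth_at (fun v : 'rV[R]_r => - v) u.
    rewrite NE; exact: smooth_at_mul_cst (smooth_at_id u).
  have sNJ := smooth_at_mul_cst J0 sN; have sc := smooth_at_cst (u0 *m J0 - h u0) u.
  split; first exact: smooth_at_add.
  rewrite (jacobian_add (smooth_at_diff sNJ) (smooth_at_diff sc)) jacobian_cst addr0.
  rewrite (jacobian_mul_cst _ (smooth_at_diff sN)) -[X in _ = - X]mul1mx -mulNmx; congr (_ *m _).
  by rewrite NE (jacobian_mul_cst _ (smooth_at_diff (smooth_at_id u))) jacobian_id mul1mx.
pose Phi u := u + (h u + lin u) *m (P *m E).
have sPhi u : smooth_at h u ->
    smooth_at Phi u /\ 'J Phi u = 1%:M + ('J h u - J0) *m (P *m E).
  move=> shu; have [sl Jl] := slin u; have sa := smooth_at_add shu sl.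
  have sm := smooth_at_mul_cst (P *m E) sa.
  split; first exact: smooth_at_add (smooth_at_id u) sm.
  rewrite (jacobian_add (smooth_at_diff (smooth_at_id u)) (smooth_at_diff sm)) jacobian_id.
  rewrite (jacobian_mul_cst _ (smooth_at_diff sa)).
  by rewrite (jacobian_add (smooth_at_diff shu) (smooth_at_diff sl)) Jl.
have alg (w : 'rV[R]_r) (B : 'M[R]_(r, m)) :
    w *m (1%:M + (B - J0) *m (P *m E)) *m K = w *m B *m P.
  rewrite mulmxDr mulmx1 mulmxDl -(mulmxA w) -(mulmxA (B - J0)) -(mulmxA P) EK mulmx1.
  by rewrite mulmxBl -/K mulmxBr addrC subrK mulmxA.
have hlin u : h u + lin u = h u - h u0 - (u - u0) *m J0.
  rewrite /lin mulmxBl mulNmx opprB -!addrA; congr (_ + _).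
  by rewrite addrCA [RHS]addrCA (addrC (- h u0)).
have Phi0 : Phi u0 = u0 by rewrite /Phi hlin !subrr mul0mx subrr mul0mx addr0.
(* [Phi] moves points only along the rows of [E], while 1 - K E is the projection killing them. Thus
   [Phi] preserves the slice through u0. *)
have PhiE u : (Phi u - u0) *m (1%:M - K *m E) = (u - u0) *m (1%:M - K *m E).
  have -> : Phi u - u0 = (u - u0) + (h u + lin u) *m (P *m E) by rewrite /Phi addrAC.
  have E0 : E *m (1%:M - K *m E) = 0 by rewrite mulmxBr mulmx1 mulmxA EK mul1mx subrr.
  by rewrite mulmxDl -(mulmxA _ (P *m E)) -(mulmxA P E) E0 !mulmx0 addr0.
have [s0 J0E] := sPhi u0 sh; rewrite -/J0 subrr mul0mx addr0 in J0E.
have uPhi : 'J Phi u0 \in unitmx by rewrite J0E unitmx1.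
have [Psi [sPsi Psi0 PsiPhi PhiPsi]] := inverse_function s0 uPhi.
rewrite Phi0 in sPsi Psi0 PhiPsi.
have cPsi := smooth_at_cont sPsi.
have goodPsi : \forall y \near u0, [/\ V (Psi y), smooth_at h (Psi y), \rank ('J h (Psi y)) = k &
    E *m 'J h (Psi y) *m P \in unitmx].
  by apply: (continuous_near (P := fun u => [/\ V u, smooth_at h u, \rank ('J h u) = k &
    E *m 'J h u *m P \in unitmx]) cPsi); rewrite Psi0.
have PhiPsi2 : \forall y \near u0, \forall z \near y, Phi (Psi z) = z.
  exact: nbhs_interior PhiPsi.
pose GP y := [/\ V (Psi y), smooth_at h (Psi y), \rank ('J h (Psi y)) = k &
    E *m 'J h (Psi y) *m P \in unitmx] /\ (\forall z \near y, Phi (Psi z) = z) /\ smooth_at Psi y.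
have all_near : \forall y \near u0, GP y.
  by apply: filterS3 goodPsi PhiPsi2 (smooth_at_near sPsi) => y ? ? ?; split.
have /nbhs_normP[d /= d0 hd] := all_near.
(* In the new variable, [v *m K = 0] means that the corresponding old direction is killed by 'J h
   followed by [P]. Rank k on both sides then forces 'J h itself to kill it. *)
have DH y v : `|y - u0| < d -> v *m K = 0 ->
    differentiable (h \o Psi) y /\ 'D_v (h \o Psi) y = 0.
  rewrite distrC => /hd[[_ shy ry uy] [nz sy]] vK.
  have dH : differentiable (h \o Psi) y.
    by apply: differentiable_comp; exact: smooth_at_diff.
  split=> //; apply: etrans (deriveE v dH) _; apply: etrans (diffJ _ _ _) _.
  rewrite (jacobian_comp (smooth_at_diff sy) (smooth_at_diff shy)) mulmxA.
  apply: goodker => //; set w := v *m 'J Psi y.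
  have [sP JP] := sPhi _ shy.
  have wE : w *m 'J Phi (Psi y) = v.
    rewrite /w -mulmxA -(jacobian_comp (smooth_at_diff sy) (smooth_at_diff sP)).
    have <- := near_eq_jacobian (f := id) (g := Phi \o Psi) (x := y).
    - by rewrite jacobian_id mulmx1.
    - by apply: filterS nz => z.
    - exact: smooth_at_diff (smooth_at_id y).
  have := vK; rewrite -[X in X *m K]wE JP alg; exact.
have Hconst y y' : `|y - u0| < d -> `|y' - u0| < d -> (y' - y) *m K = 0 ->
    h (Psi y') = h (Psi y).
  move=> yd yd' yK; apply/eqP; rewrite -subr_eq0 -normr_le0.
  apply: (@mean_value_bound R r m (h \o Psi) y y' 0) => // t t01.
  by have [dH ->] := DH _ _ (segment_ball t01 yd yd') yK; rewrite normr0.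
have /nbhs_normP[rho /= rho0 hrho] := good.
have [CE CE0 hCE] := mulmx_bound E.
have [CK CK0 hCK] := mulmx_bound K.
have [CKE CKE0 hCKE] := mulmx_bound (K *m E).
pose e := rho / CE; have e0 : 0 < e by rewrite divr_gt0.
exists E, e; split=> //.
  move=> w we; have : `|u0 - (u0 + w *m E)| < rho.
    rewrite opprD addNKr normrN; apply: le_lt_trans (hCE w) _.
    by rewrite mulrC -ltr_pdivlMr.
  move=> /hrho[Vw _ rw uw]; split=> //; apply/eqP; rewrite eqn_leq rank_leq_row /=.
  by rewrite -[X in (X <= _)%N](mxrank_unit uw); exact: mxrankM_maxl.
have eCK : 0 < e / CK by rewrite divr_gt0.
have nPsi : \forall y \near u0, `|u0 - Psi y| < e / CK.
  apply: (continuous_near (P := fun z => `|u0 - z| < e / CK) cPsi).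
  by rewrite Psi0; exact: near_dist_lt.
pose GP2 y := GP y /\ `|u0 - Psi y| < e / CK.
have all_near2 : \forall y \near u0, GP2 y.
  by apply: filterS2 all_near nPsi => y ? ?; split.
have /nbhs_normP[d2 /= d20 hd2] := all_near2.
pose d3 := Num.min d (Num.min d d2 / CKE).
have d30 : 0 < d3 by rewrite lt_min d0 divr_gt0// lt_min d0.
have cPhi := smooth_at_cont s0.
have nPhi : \forall u \near u0, `|u0 - Phi u| < d3.
  apply: (continuous_near (P := fun z => `|u0 - z| < d3) cPhi).
  by rewrite Phi0; exact: near_dist_lt.
apply: filterS2 PsiPhi nPhi => u PsiPhiu; set y := Phi u in PsiPhiu *.
rewrite lt_min distrC => /andP[yd ydK].
(* The point with the same [K] coordinates as [y], so h o Psi takes the same value there, and with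
   no component off the slice, so [Psi y'] lies on the slice. *)
pose y' := u0 + (y - u0) *m (K *m E).
have y'E : y' - u0 = (y - u0) *m (K *m E) by rewrite /y' addrC addKr.
have : `|y' - u0| < Num.min d d2.
  rewrite y'E; apply: le_lt_trans (hCKE _) _.
  by rewrite mulrC -ltr_pdivlMr.
rewrite lt_min => /andP[yd' yd2'].
have [[_ [nz _]] ny'] : GP2 y' by apply: hd2; rewrite /= distrC.
have PP : Phi (Psi y') = y' := nbhs_singleton nz.
have PK : K *m (E *m K) = K by rewrite EK mulmx1.
exists ((Psi y' - u0) *m K).
  by apply: le_lt_trans (hCK _) _; rewrite mulrC -ltr_pdivlMr// distrC.
have uE : u0 + (Psi y' - u0) *m K *m E = Psi y'.
  have := PhiE (Psi y'); rewrite PP y'E -mulmxA.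
  have -> : K *m E *m (1%:M - K *m E) = 0.
    by rewrite mulmxBr mulmx1 mulmxA -(mulmxA K) PK subrr.
  rewrite mulmx0 mulmxBr mulmx1 mulmxA => /esym/eqP.
  by rewrite subr_eq0 => /eqP <-; rewrite addrC subrK.
rewrite uE -[in RHS]PsiPhiu; apply: Hconst => //.
rewrite -(subrKA u0) y'E -(opprB y u0) mulmxDl mulNmx -mulmxA -(mulmxA K) PK.
by rewrite subrr.
Qed.

(** * The image of a map of constant rank *)

Lemma hausdorff_prod (T U : topologicalType) :
  hausdorff_space T -> hausdorff_space U -> hausdorff_space (T * U)%type.
Proof.
move=> hT hU [a b] [a' b'] cl; congr pair.
  apply: hT => A B nA nB.
  have [||[x y] [/= [Ax _] [Bx _]]] := cl (A `*` setT) (B `*` setT).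
  - by exists (A, setT) => //; split=> //; exact: filterT.
  - by exists (B, setT) => //; split=> //; exact: filterT.
  - by exists x.
apply: hU => A B nA nB.
have [||[x y] [/= [_ Ay] [_ By]]] := cl (setT `*` A) (setT `*` B).
- by exists (setT, A) => //; split=> //; exact: filterT.
- by exists (setT, B) => //; split=> //; exact: filterT.
- by exists y.
Qed.

Lemma rat_approx (R : realType) (k : nat) (v : 'rV[R]_k) (e : R) : 0 < e ->
  exists q : 'rV[rat]_k, `|map_mx ratr q - v| < e.
Proof.
move=> e0; have e20 : 0 < e / 2 by rewrite divr_gt0.
have ex (i : 'I_k) : exists r : rat, `|ratr r - v 0 i| <= e / 2.
  have /rat_in_itvoo[r /itvP h] : v 0 i < v 0 i + e / 2 by rewrite ltrDl.
  exists r; rewrite ger0_norm ?subr_ge0 ?h// lerBlDr addrC ltW// h//.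
exists (\row_i projT1 (cid (ex i))).
apply: (@le_lt_trans _ _ (e / 2)); last by rewrite ltr_pdivrMr// ltr_pMr// ltr1n.
apply/norm_rV_le => [|i]; first exact: ltW.
by rewrite !mxE; case: cid.
Qed.

Lemma nbhs_nat_prod (T : topologicalType) (n : nat) (v : T) (P : set (nat * T)) :
  (nbhs (n, v) P <-> \forall u \near v, P (n, u)).
Proof.
split=> [[[A B] /= [nA nB] AB]|nP].
  by apply: filterS nB => u Bu; apply: AB; split=> //=; exact: nbhs_singleton nA.
exists ([set n], [set u | P (n, u)]) => /=; last by move=> [a b] /= [->].
by split=> //; apply/nbhs_principalE/principal_filterP.
Qed.

Section Slices.
Variables (R : realType) (k : nat).
Local Notation S := (nat * 'rV[R]_k)%type.

Lemma slices_second_countable : @second_countable S.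
Proof.
pose b (t : nat * 'rV[rat]_k * nat) : set S :=
  [set t.1.1] `*` [set v | `|map_mx ratr t.1.2 - v| < t.2.+1%:R^-1].
have bo t : open (b t).
  rewrite openE => -[n v] [/= -> tv]; apply/nbhs_nat_prod.
  have : open [set v : 'rV[R]_k | `|map_mx ratr t.1.2 - v| < t.2.+1%:R^-1].
    by have := @ball_open _ _ (map_mx ratr t.1.2 : 'rV[R]_k) (t.2.+1%:R^-1); rewrite -ball_normE.
  by rewrite openE => /(_ v tv); apply: filterS.
exists (range b); first exact: (sub_countable (card_image_le b setT) (countableP _)).
split=> [_ [t _ <-]|[n v] P /nbhs_nat_prod]; first exact: bo.
move=> /nbhs_normP[e /= e0 he].
have [j hj] : exists j : nat, j.+1%:R^-1 < e / 2.
  have e20 : 0 < e / 2 by rewrite divr_gt0.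
  by have [j] := ltr_add_invr e20; rewrite add0r; exists j.
have j0 : 0 < j.+1%:R^-1 :> R by rewrite invr_gt0.
have [q hq] := @rat_approx R k v (j.+1%:R^-1) j0.
exists (b (n, q, j)); first by split=> //; exists (n, q, j).
move=> [n' v'] [/= -> vq]; apply: he => /=.
rewrite -(subrKA (map_mx ratr q)); apply: le_lt_trans (ler_normD _ _) _.
rewrite (splitr e) distrC; apply: ltrD; exact: lt_trans hj.
Qed.

(** Countably many disjoint copies of R^k, the sheets being indexed by a discrete [nat]. The chart
    at x covers exactly the sheet of x, and is the second projection. *)
Definition slices : manifold R k.
Proof.
refine (@Manifold R k S (fun x => [set x.1] `*` setT) (fun _ y => y.2) (fun x u => (x.1, u))
  _ slices_second_countable _ _ _ _ _ _ _).
- by apply: hausdorff_prod; [exact: discrete_hausdorff|exact: norm_hausdorff].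
- move=> [n v]; rewrite openE => -[n' u] [/= -> _]; apply/nbhs_nat_prod.
  exact: filterS (@filterT _ (nbhs u) _).
- by [].
- move=> x; suff -> : (fun y : S => y.2) @` ([set x.1] `*` setT) = setT by exact: openT.
  by apply/seteqP; split=> [//|u _]; exists (x.1, u).
- by move=> [n v] [n' u] [/= ->].
- by move=> x [n u] _ P nP; apply/nbhs_nat_prod.
- by move=> x u _ P /nbhs_nat_prod.
- move=> [n u] [n' v] j; apply/Ck_onE.
  apply: (@Cn_sub _ _ _ _ _ setT) => //.
  by apply: Cn_id; exact: openT.
Defined.

End Slices.

Lemma norm_rV_lt (R : realType) (n : nat) (v : 'rV[R]_n) (e : R) :
  0 < e -> (forall i, `|v 0 i| < e) -> `|v| < e.
Proof.
move=> e0 h; rewrite /Num.Def.normr /= mx_normrE.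
by apply: bigmax_lt => // ij _ /=; rewrite (ord1 ij.1); exact: h.
Qed.

Lemma atan_comp_derive (R : realType) (m : nat) (f : 'rV[R]_m -> R) x v :
  differentiable f x -> differentiable (fun y => atan (f y)) x /\
  'D_v (fun y => atan (f y)) x = (1 + f x * f x)^-1 * 'D_v f x.
Proof.
move=> df; have dat : differentiable (@atan R) (f x).
  by apply/derivable1_diffP; exact: derivable_atan.
have dc : differentiable (atan \o f) x by exact: differentiable_comp.
split; first exact: dc.
apply: etrans (deriveE v dc) _; apply: etrans (congr1 (fun F => F v) (diff_comp df dat)) _ => /=.
apply: etrans (congr1 (fun F => F ('d f x v)) (deriv1E (@derivable_atan R (f x)))) _.
by rewrite /= derive1_atan deriveE// expr2 /GRing.scale /= mulrC.
Qed.

Lemma Cn_atan (R : realType) (m k : nat) (A : set 'rV[R]_m) (f : 'rV[R]_m -> R) :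
  open A -> Cn k A f -> Cn k A (fun x => atan (f x)).
Proof.
move=> oA; elim: k => [|k IHk] Cf.
  by move=> x Ax; apply: (@continuous_comp _ _ _ f (@atan R)); [exact: Cf|exact: continuous_atan].
have [df Df] := Cf; split=> [x Ax|v]; first by have [] := atan_comp_derive 0 (df x Ax).
have Cg : Cn k A (fun x => (1 + f x * f x)^-1).
  apply: Cn_inv => // [x _|]; first by rewrite gt_eqF// ltr_wpDr// -expr2 sqr_ge0.
  apply: Cn_add => //; first exact: Cn_cst.
  by apply: Cn_mul => //; exact: CnS.
apply: Cn_ext (Cn_mul oA Cg (Df v)) => // x Ax.
by have [_ ->] := atan_comp_derive v (df x Ax).
Qed.

(* A diffeomorphism of R^k onto the open cube of half-side e. *)
Definition box (R : realType) (k : nat) (e : R) (t : 'rV[R]_k) : 'rV[R]_k :=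
  \row_j (e / (pi / 2) * atan (t 0 j)).

Section Box.
Variables (R : realType) (k : nat) (e : R).
Hypothesis e0 : 0 < e.
Local Notation box := (@box R k e).

Let p2 : 0 < pi / 2 :> R. Proof. by rewrite divr_gt0// pi_gt0. Qed.
Let c0 : 0 < e / (pi / 2). Proof. by rewrite divr_gt0. Qed.

Lemma box_lt t : `|box t| < e.
Proof.
apply: norm_rV_lt => // i; rewrite mxE normrM gtr0_norm// mulrAC ltr_pdivrMr// ltr_pM2l//.
by rewrite ltr_norml atan_gtNpi2 atan_ltpi2.
Qed.

Lemma box_surj w : `|w| < e -> exists t, box t = w.
Proof.
move=> we; exists (\row_j tan (w 0 j / (e / (pi / 2)))); apply/rowP => j; rewrite !mxE.
rewrite tanK; first by rewrite mulrC divfK// gt_eqF.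
have : `|w 0 j| < e := le_lt_trans (norm_coord_le w j) we.
rewrite ltr_norml => /andP[w1 w2]; rewrite in_itv /=.
rewrite ltr_pdivlMr// ltr_pdivrMr// mulNr.
by rewrite [pi / 2 * _]mulrC divfK ?gt_eqF// w1.
Qed.

Lemma box_smooth t : smooth_at box t.
Proof.
exists setT; split=> //; first exact: openT.
move=> n; apply/(Cn_mxP n _ openT) => i j.
have -> : (fun x : 'rV[R]_k => box x i j) = (fun x => e / (pi / 2) * atan (x 0 j)).
  by apply/funext => x; rewrite mxE.
apply: Cn_mul; [exact: openT|exact: Cn_cst|].
apply: Cn_atan; first exact: openT.
exact: ((Cn_mxP n _ openT).1 (Cn_id n openT) 0 j).
Qed.

Lemma box_unit t : 'J box t \in unitmx.
Proof.
rewrite -row_free_unit; apply/inj_row_free => v vJ; apply/rowP => j.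
have db := smooth_at_diff (box_smooth t).
have : ('D_v box t) 0 j = 0.
  by rewrite (deriveE v db) diffJ vJ mxE.
have dco : differentiable (fun x : 'rV[R]_k => x 0 j) t by exact: differentiable_coord.
have [dat datE] := atan_comp_derive v dco.
rewrite derive_mx; last exact: diff_derivable.
rewrite mxE.
have -> : (fun x : 'rV[R]_k => box x 0 j) = (e / (pi / 2)) \*: (fun x => atan (x 0 j)).
  by apply/funext => x; rewrite mxE.
rewrite deriveZ; last exact: diff_derivable.
rewrite datE => /eqP; rewrite scaler_eq0 gt_eqF//= mulf_eq0 invr_eq0.
rewrite gt_eqF ?ltr_wpDr// -?expr2 ?sqr_ge0//= => /eqP.
have -> : 'D_v (fun x : 'rV[R]_k => x 0 j) t = v 0 j.
  have := derive_mx (diff_derivable (v := v) (smooth_at_diff (smooth_at_id t))).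
  by rewrite derive_id => /rowP/(_ j) ->; rewrite mxE.
by rewrite mxE.
Qed.

End Box.

(** Every x lies in a basic open set contained in some member of the family. Choosing one member for
    each such basic set leaves countably many. *)
Lemma lindelof_sequence (T : topologicalType) (U : T -> set T) (z0 : T) :
  @second_countable T -> (forall z, nbhs z (U z)) ->
  exists s : nat -> T, forall x, exists n, U (s n) x.
Proof.
move=> [B /countable_injP[f finj] [Bo Bb]] nU.
(* Numbers that code no suitable basic set get the default [z0]. *)
exists (fun n => xget z0 [set z | exists b, [/\ B b, f b = n & b `<=` U z]]) => x.
have [b /= [Bb' bx] bU] := Bb x (U x) (nU x); exists (f b).
have [|b' [Bb'' fb' b'U]] := @xgetPex _ z0 [set z | exists b', [/\ B b', f b' = f b & b' `<=` U z]].
  by exists x, b.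
by apply: b'U; rewrite (finj b' b _ _ fb')// inE.
Qed.

Lemma range_mulmx_eq (F : fieldType) (a b c : nat) (X : 'M[F]_(a, b)) (A : 'M[F]_(b, c)) :
  \rank (X *m A) = \rank A ->
  range (fun v : 'rV[F]_a => v *m (X *m A)) = range (fun v : 'rV[F]_b => v *m A).
Proof.
move=> rk; apply/seteqP; split=> [_ [v _ <-]|_ [v _ <-]].
  by exists (v *m X) => //; rewrite mulmxA.
have := (mxrank_leqif_eq (submxMl X A)).2; rewrite rk eqxx => /esym/andP[_ h].
have : (v *m A <= X *m A)%MS by apply: submx_trans h; exact: submxMl.
by move=> /submxP[w ->]; exists w.
Qed.

Lemma rank_unit_mull (F : fieldType) (n p : nat) (A : 'M[F]_n) (B : 'M[F]_(n, p)) :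
  A \in unitmx -> \rank (A *m B) = \rank B.
Proof. by move=> uA; rewrite eqmxMfull// row_full_unit. Qed.

Lemma rank_unit_mulr (F : fieldType) (n p : nat) (A : 'M[F]_p) (B : 'M[F]_(n, p)) :
  A \in unitmx -> \rank (B *m A) = \rank B.
Proof. by move=> uA; rewrite mxrankMfree// row_free_unit. Qed.

Lemma tangentE (R : realType) (m p : nat) (M : manifold R m) (N : manifold R p)
    (f : N -> M) x : tangent f x = range (fun v : 'rV[R]_p => v *m mJ f x).
Proof.
by apply/seteqP; split=> _ [v _ <-]; exists v; rewrite ?mdiffE.
Qed.

Section ConstantRank.
Variables (R : realType) (r m k : nat) (I : manifold R r) (Q : manifold R m) (g : I -> Q).
Hypothesis sg : smooth_map g.
Hypothesis rg : forall z, \rank (mJ g z) = k.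

Lemma rank_loc (z z' : I) (y : Q) : dom I z z' -> dom Q y (g z') ->
  \rank ('J (loc z y g) (chart I z z')) = k.
Proof.
move=> dz dy; rewrite (smooth_map_mJ sg dz dy).
rewrite rank_unit_mulr; last by apply: transition_unit => //; exact: dom_self.
by rewrite rank_unit_mull ?rg//; apply: transition_unit => //; exact: dom_self.
Qed.

(** The slice of the coordinate expression, shrunk so that it stays in the chart at z and its image
    in the chart at g z. Injectivity of the latter turns equal coordinates into equal values of
    g. *)
Lemma local_slice (z : I) : exists (E : 'M[R]_(k, r)) (e : R), [/\ 0 < e,
  forall w : 'rV[R]_k, `|w| < e ->
    let u := chart I z z + w *m E in
    [/\ dom I z (chart_inv I z u), chart I z (chart_inv I z u) = u,
      dom Q (g z) (g (chart_inv I z u)) & \rank (E *m 'J (loc z (g z) g) u) = k] &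
  \forall z' \near z, exists2 w : 'rV[R]_k, `|w| < e &
    g (chart_inv I z (chart I z z + w *m E)) = g z'].
Proof.
have dz := dom_self z; have dgz := dom_self (g z).
pose V u := [/\ dom I z (chart_inv I z u), chart I z (chart_inv I z u) = u &
  dom Q (g z) (g (chart_inv I z u))].
have nV : \forall u \near chart I z z, V u.
  have := chart_image_nbhs dz (sg.1 z _ (near_chart dgz)).
  by apply: filterS2 (near_chart_inv dz) => u [du Eu] dgu; split.
have sh := smooth_map_loc sg dz dgz.
have rh : \forall u \near chart I z z, \rank ('J (loc z (g z) g) u) = k.
  by apply: filterS nV => u [du uE dgu]; rewrite -[X in 'J _ X]uE rank_loc.
have [E [e [e0 hw nw]]] := constant_rank_slice sh rh nV.
exists E, e; split=> //.
  by move=> w /hw[[? ? ?] ?].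
have := chart_preimage_nbhs dz nw.
apply: filterS3 (near_chart dz) (sg.1 z _ (near_chart dgz)) => z' dz' dgz' [w we E'].
exists w => //; have [[_ _ dgw] _] := hw w we.
rewrite -[LHS](chartK dgw) -[RHS](chartK dgz'); congr (chart_inv Q _ _).
by move: E'; rewrite loc_chart.
Qed.

(** The composite of the slices with g has rank k on a k-dimensional source, so it is an immersion.
    Its tangent spaces lie in those of g and have the same dimension. *)
Theorem constant_rank_image : exists q (S : manifold R q) (f : S -> Q),
  [/\ immersion f, range f = range g &
      forall w, exists2 z, f w = g z & tangent f w = tangent g z].
Proof.
(* If I is empty, g itself is vacuously an immersion. *)
have [[z0 _]|Iempty] := pselect ([set: I] !=set0); last first.
  exists r, I, g; split=> //; [|by move=> w; exists w].
  by split=> // z; case: Iempty; exists z.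
have [E /choice[e slice]] := choice local_slice.
(* Not the slice at z but the set of points whose value is attained on it; this is a neighbourhood
   of z, so countably many cover I. *)
pose U z := [set z' | exists2 w : 'rV[R]_k, `|w| < e z &
  g (chart_inv I z (chart I z z + w *m E z)) = g z'].
have nU z : nbhs z (U z) by have [_ _] := slice z.
have [s cover] := lindelof_sequence z0 (@manifold_countable _ _ I) nU.
have e0 z : 0 < e z by have [] := slice z.
pose line z (t : 'rV[R]_k) := chart I z z + box (e z) t *m E z.
have lineP z t : [/\ dom I z (chart_inv I z (line z t)),
    chart I z (chart_inv I z (line z t)) = line z t,
    dom Q (g z) (g (chart_inv I z (line z t))) &
    \rank (E z *m 'J (loc z (g z) g) (line z t)) = k].
  by have [_ + _] := slice z; apply; exact: box_lt.
have sline z t : smooth_at (line z) t.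
  apply: smooth_at_add; first exact: smooth_at_cst.
  by apply: smooth_at_mul_cst; exact: box_smooth.
have Jline z t : 'J (line z) t = 'J (box (e z)) t *m E z.
  have db := smooth_at_diff (@box_smooth R k (e z) t).
  rewrite jacobian_add; [|exact: differentiable_cst|exact: smooth_at_diff (smooth_at_mul_cst _ (box_smooth _ _))].
  by rewrite jacobian_cst add0r jacobian_mul_cst.
pose S := slices R k.
pose sg' (x : S) : I := chart_inv I (s x.1) (line (s x.1) x.2).
have locs (x : S) : loc x (s x.1) sg' = line (s x.1).
  by apply/funext => u; rewrite /loc /sg' /=; have [_ -> _ _] := lineP (s x.1) u.
have ssg : smooth_map sg'.
  apply/smooth_mapP; split=> [[n t]|x].
    move=> P nP; apply/nbhs_nat_prod.
    have [dl lE _ _] := lineP (s n) t.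
    have cl := smooth_at_cont (sline (s n) t).
    apply: (continuous_near (P := fun u => P (chart_inv I (s n) u)) cl).
    by rewrite -lE; apply: chart_image_nbhs => //; rewrite lE.
  have [dl lE _ _] := lineP (s x.1) x.2.
  by exists x, (s x.1); split=> //; rewrite locs; exact: sline.
have [sf Jf] := smooth_map_comp ssg sg.
have rf w : \rank (mJ (g \o sg') w) = k.
  have [dl lE dgl rl] := lineP (s w.1) w.2.
  have dw := dom_self w.
  have [_ J1] := loc_comp (g := g) (z0 := g (s w.1)) dw dl (ssg.1 w)
    (smooth_map_loc ssg dw dl) (smooth_map_loc sg dl dgl).
  have : \rank ('J (loc w (g (s w.1)) (g \o sg')) (chart S w w)) = k.
    rewrite J1 locs [sg' w]/(sg' w) lE Jline -mulmxA.
    by rewrite rank_unit_mull// box_unit.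
  rewrite (smooth_map_mJ sf dw dgl).
  rewrite rank_unit_mulr; last by apply: transition_unit => //; exact: dom_self.
  by rewrite rank_unit_mull//; apply: transition_unit => //; exact: dom_self.
exists k, S, (g \o sg'); split.
- split=> // w; apply/injective_mdiffP; rewrite /row_free rf eqxx.
  by [].
- apply/seteqP; split=> [_ [x _ <-]|_ [z _ <-]]; first by exists (sg' x).
  have [n [w we gw]] := cover z; have [t tw] := box_surj (e0 (s n)) we.
  by exists (n, t) => //; rewrite -gw -tw.
- move=> w; exists (sg' w) => //; rewrite !tangentE Jf; apply: range_mulmx_eq.
  by rewrite -Jf rf rg.
Qed.

End ConstantRank.

(** * Surjective immersions do not raise the dimension *)

Lemma compact_normball (R : realType) (n : nat) (x0 : 'rV[R]_n) (r : R) :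
  compact [set x : 'rV[R]_n | `|x - x0| <= r].
Proof.
apply: bounded_closed_compact; last exact: closed_normball.
exists (`|x0| + r); split; first exact: num_real.
move=> M hM x /= xr; apply: ltW; apply: le_lt_trans hM.
by rewrite -[x](subrK x0) addrC; apply: le_trans (ler_normD _ _) _; rewrite lerD2l.
Qed.

(** The image of a small closed coordinate ball is compact, hence closed. Following the immersion by
    a left inverse of its differential is injective on the ball, and when k < q that linear map has
    a kernel: moving off the image along the kernel leaves it at once. *)
Lemma immersion_locally_thin (R : realType) (k q : nat) (A : manifold R k) (B : manifold R q)
    (f : A -> B) (a : A) : immersion f -> (k < q)%N ->
  exists C : set B, [/\ closed C, \forall a' \near a, C (f a') &
    forall b (O : set B), C b -> nbhs b O -> exists2 b', O b' & ~ C b'].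
Proof.
move=> [sf inj] kq; have da := dom_self a; have dfa := dom_self (f a).
have sh := smooth_map_loc sf da dfa; set h := loc a (f a) f in sh.
set u0 := chart A a a in sh.
have /row_freeP[P JP] := (injective_mdiffP f a).1 (inj a).
have [c c0 hc] := mulmx_bound P.
(* With [c] bounding [P], this makes h followed by [P] differ from the identity by a map of
   Lipschitz constant 1/2, hence injective near [u0]. *)
have e0 : 0 < (2 * c)^-1 by rewrite invr_gt0 mulr_gt0.
have [d d0 strict] := smooth_at_strict sh e0.
have hinj u v : `|u - u0| < d -> `|v - u0| < d -> h u *m P = h v *m P -> u = v.
  move=> ud vd E; have := strict u v ud vd; rewrite -(ler_pM2l c0) => le.
  have := le_trans (hc _) le; rewrite mulmxBl [in X in `|X|]mulmxBl E subrr sub0r.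
  rewrite normrN -mulmxA JP mulmx1 mulrA invfM mulrCA mulfV ?gt_eqF// mulr1.
  move=> H; apply/eqP; rewrite eq_sym -subr_eq0 -normr_le0.
  by move: H; set X := `|_|; lra.
have good : \forall u \near u0, [/\ dom A a (chart_inv A a u), chart A a (chart_inv A a u) = u &
    dom B (f a) (f (chart_inv A a u))].
  have := chart_image_nbhs da (sf.1 a _ (near_chart dfa)).
  by apply: filterS2 (near_chart_inv da) => u [? ?] ?; split.
have /nbhs_normP[d' /= d'0 hd'] := good.
pose rho := Num.min d d' / 2.
have rho0 : 0 < rho by rewrite divr_gt0// lt_min d0.
have rd : rho < Num.min d d' by rewrite /rho ltr_pdivrMr// ltr_pMr ?ltr1n// lt_min d0.
have /andP[rd1 rd2] : (rho < d) && (rho < d') by rewrite -lt_min.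
pose Kb := [set u : 'rV[R]_k | `|u - u0| <= rho].
have KP u : Kb u -> [/\ dom A a (chart_inv A a u), chart A a (chart_inv A a u) = u,
    dom B (f a) (f (chart_inv A a u)) & `|u - u0| < d].
  move=> uK; have [|? ? ?] := hd' u; first by rewrite /= distrC; exact: le_lt_trans rd2.
  by split=> //; exact: le_lt_trans rd1.
exists ((f \o chart_inv A a) @` Kb); split.
- apply: compact_closed; first exact: manifold_hausdorff.
  apply: continuous_compact; last exact: compact_normball.
  apply: continuous_in_subspaceT => u; rewrite inE => /KP[du uE _ _].
  apply: continuous_comp; last exact: sf.1.
  by apply: (@chart_inv_continuous _ _ A a); exists (chart_inv A a u).
- have := chart_preimage_nbhs da (near_dist_lt u0 rho0).
  apply: filterS2 (near_chart da) => a' da' a'r; exists (chart A a a'); last by rewrite /= chartK.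
  by rewrite /Kb /= distrC ltW.
- move=> _ O [u uK <-] nO; have [du uE dfu ud] := KP u uK.
  set b := f (chart_inv A a u) in dfu nO *.
  (* The escape direction. A point y + t w of the image would have the same [P] value as y, hence
     the same preimage, which forces t w = 0. *)
  have [w w0 wP] : exists2 w : 'rV[R]_q, w != 0 & w *m P = 0.
    have : (0 < \rank (kermx P))%N.
      by rewrite mxrank_ker subn_gt0; apply: leq_ltn_trans kq; exact: rank_leq_col.
    rewrite lt0n mxrank_eq0 => kn0; have [i ri] : exists i, row i (kermx P) != 0.
      apply/existsP; apply: contraNT kn0; rewrite negb_exists => /forallP h0.
      by apply/eqP/row_matrixP => i; rewrite row0; apply/eqP; rewrite -[_ == _]negbK.
    by exists (row i (kermx P)) => //; rewrite -row_mul mulmx_ker row0.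
  have nn : \forall v \near chart B (f a) b, (dom B (f a) (chart_inv B (f a) v) /\
      chart B (f a) (chart_inv B (f a) v) = v) /\ O (chart_inv B (f a) v).
    exact: filterI (near_chart_inv dfu) (chart_image_nbhs dfu nO).
  have /nbhs_normP[s /= s0 hs] := nn.
  pose t := s / (2 * `|w|).
  have w00 : 0 < `|w| by rewrite normr_gt0.
  have t0 : 0 < t by rewrite divr_gt0// mulr_gt0.
  set y := chart B (f a) b in hs nn; pose y' := y + t *: w.
  have : `|y - y'| < s.
    rewrite /y' opprD addNKr normrN normrZ gtr0_norm// /t.
    rewrite [X in X < _](_ : _ = s / 2); last by field; rewrite gt_eqF.
    by rewrite ltr_pdivrMr// ltr_pMr// ltr1n.
  move=> /hs[[dy' y'E] Oy']; exists (chart_inv B (f a) y') => //.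
  move=> [u' u'K /= Eu']; have [du' u'E dfu' ud'] := KP u' u'K.
  have hu' : h u' = y' by rewrite /h /loc /= Eu' y'E.
  have hu : h u = y by [].
  have : u' = u.
    by apply: hinj => //; rewrite hu' hu /y' mulmxDl -scalemxAl wP scaler0 addr0.
  move=> uu; move: hu'; rewrite uu hu /y' => /eqP.
  rewrite -[X in X == _]addr0 => /eqP/addrI/esym/eqP.
  by rewrite scaler_eq0 (negbTE w0) orbF gt_eqF.
Qed.

(** If k < q, second countability of A covers B by countably many closed sets with empty interior,
    against Baire's theorem in a chart around [b0]. *)
Lemma surjective_immersion_dim (R : realType) (k q : nat) (A : manifold R k) (B : manifold R q)
    (f : A -> B) (b0 : B) : immersion f -> range f = setT -> (q <= k)%N.
Proof.
move=> imf fsurj; rewrite leqNgt; apply/negP => kq.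
have [a0 _ _] : range f b0 by rewrite fsurj.
have thin a := immersion_locally_thin a imf kq.
have [C hC] := choice thin.
pose U a := [set a' | C a (f a')].
have nU a : nbhs a (U a) by have [_ + _] := hC a.
have [s cover] := lindelof_sequence a0 (@manifold_countable _ _ A) nU.
have db := dom_self b0; set u0 := chart B b0 b0.
have /nbhs_normP[d /= d0 hd] := near_chart_inv db.
pose rho := d / 2.
have rho0 : 0 < rho by rewrite divr_gt0.
have rd : rho < d by rewrite /rho ltr_pdivrMr// ltr_pMr// ltr1n.
pose Kb := [set u : 'rV[R]_q | `|u - u0| <= rho].
have KP u : Kb u -> dom B b0 (chart_inv B b0 u) /\ chart B b0 (chart_inv B b0 u) = u.
  by move=> uK; apply: hd => /=; rewrite distrC; exact: le_lt_trans rd.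
(* Intersecting with a closed ball inside the chart image makes the trace closed in the whole of
   R^q, where Baire's theorem is applied. *)
pose G n := [set u | Kb u /\ C (s n) (chart_inv B b0 u)].
have [|||u [/= ur Gu]] := @Baire R 'rV[R]_q (fun n => ~` G n) _ [set u | `|u0 - u| < rho].
- move=> n; have [clC _ thinC] := hC (s n); split.
    rewrite openE => u nGu; rewrite /interior.
    have [uK|uK] := pselect (Kb u).
      have [du uE] := KP u uK.
      have nC : nbhs (chart_inv B b0 u) (~` C (s n)).
        apply: open_nbhs_nbhs; split; first exact: closed_openC.
        by move=> Cu; apply: nGu.
      have := chart_image_nbhs du nC; rewrite uE.
      by apply: filterS => v nCv [_ Cv].
    have nK : nbhs u (~` Kb).
      apply: open_nbhs_nbhs; split=> //; apply: closed_openC; exact: closed_normball.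
    by apply: filterS nK => v nKv [Kv _].
  move=> D [u Du] oD; have [Gu|nGu] := pselect (G n u); last by exists u.
  have [uK Cu] := Gu; have [du uE] := KP u uK.
  have nD : nbhs (chart B b0 (chart_inv B b0 u)) D.
    by rewrite uE; apply: open_nbhs_nbhs.
  have [b' [Db' db'] nCb'] := thinC _ _ Cu (filterI (chart_preimage_nbhs du nD) (near_chart du)).
  by exists (chart B b0 b'); split=> // -[_]; rewrite chartK.
- by exists u0; rewrite /= subrr normr0.
- have := @ball_open _ _ (u0 : 'rV[R]_q) rho; rewrite -ball_normE; exact.
have [a _ fa] : range f (chart_inv B b0 u) by rewrite fsurj.
have [n Ua] := cover a; apply: (Gu n I); split; last by rewrite -fa.
by rewrite /Kb /= distrC ltW.
Qed.

(** * Embedded images and the reduction theorem *)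

(** The lift of f to Q is a surjective immersion, so dim Q <= k; the rank of f gives k <= dim Q.
    Tangent spaces of f and Q then coincide, and each point of Q comes from a point of A. *)
Lemma legendrian_embedded (R : realType) (m k q : nat) (M : manifold R m) (eta : oneform M)
    (A : manifold R k) (f : A -> M) (Q : manifold R q) (i : Q -> M) :
  immersion f -> legendrian eta f -> embedding i -> range i = range f -> legendrian eta i.
Proof.
move=> imf lf emi rif x; have [[si di] iinj _] := emi.
have /choice[j ij] : forall a, exists y, i y = f a.
  move=> a; have : range i (f a) by rewrite rif; exists a.
  by move=> [y _ <-]; exists y.
have sj := embedding_lift imf.1 emi ij.
have fE : i \o j = f by apply/funext.
have Jf a : mJ f a = mJ j a *m mJ i (j a) by rewrite -fE (smooth_map_comp sj si).2.
have rfa a : row_free (mJ f a) by apply/injective_mdiffP; exact: imf.2.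
have rja a : row_free (mJ j a).
  have := rfa a; rewrite /row_free Jf !eqn_leq !rank_leq_row /= => /leq_trans; apply.
  exact: mxrankM_maxl.
have jsurj y : exists a, j a = y.
  have : range f (i y) by rewrite -rif; exists y.
  by move=> [a _ fa]; exists a; apply: iinj; rewrite ij.
have imj : immersion j by split=> // a; apply/injective_mdiffP.
have qk : (q <= k)%N.
  apply: (surjective_immersion_dim x imj); apply/seteqP; split=> // y _.
  by have [a <-] := jsurj y; exists a.
have [a jax] := jsurj x.
have rx : \rank (mJ i (j a)) = q by apply/eqP; exact: (injective_mdiffP i (j a)).1.
have rf : \rank (mJ f a) = k by apply/eqP; exact: rfa.
have kq : (k <= q)%N.
  have : (\rank (mJ f a) <= \rank (mJ i (j a)))%N by rewrite Jf; exact: mxrankM_maxr.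
  by rewrite rf rx.
have TE : tangent f a = tangent i x.
  rewrite !tangentE -jax Jf; apply: range_mulmx_eq; rewrite -Jf rf rx.
  by apply/eqP; rewrite eqn_leq qk kq.
by have := lf a; rewrite TE -ij jax.
Qed.

Theorem corollary14 (R : realType) (n d l k : nat)
    (M : manifold R n.*2.+1) (eta : oneform M) (heta : contact_form eta)
    (N : submanifold M d)
    (hN : coisotropic eta (incl_map N))
    (hNhor : forall x : N, ~ horizontal eta (incl_map N) x)
    (Nt : manifold R k.*2.+1) (proj : N -> Nt)
    (hproj : leaf_space (characteristic eta (incl_map N)) proj)
    (etat : oneform Nt) (hetat : contact_form etat)
    (hpull : forall (x : N) (v : 'rV[R]_d),
       pairing (etat (proj x)) (mdiff proj x v) =
       pairing (eta (incl_map N x)) (mdiff (incl_map N) x v))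
    (L : submanifold M l)
    (hL : legendrian eta (incl_map L))
    (hclean : clean_intersection N L) :
  legendrian_submanifold etat
    (proj @` (incl_map N @^-1` range (incl_map L))).
Proof.
have [r [I [rI tI]]] := hclean.
have [[sN iN] injN _] := incl_map_embedding N.
have [[sI iI] _ _] := incl_map_embedding I.
have [[sp psurj] _ _] := hproj.
(* [I] is the manifold carrying N /\ L; [j] and [jL] name its points in N and in L. Only [j] has to
   be smooth, since the quotient map is applied to it. *)
have /choice[j ij] : forall z : I, exists x : N, incl_map N x = incl_map I z.
  move=> z; have : range (incl_map I) (incl_map I z) by exists z.
  by rewrite rI => -[[x _ <-] _]; exists x.
have /choice[jL ijL] : forall z : I, exists y : L, incl_map L y = incl_map I z.
  move=> z; have : range (incl_map I) (incl_map I z) by exists z.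
  by rewrite rI => -[_ [y _ <-]]; exists y.
have sj := embedding_lift sI (incl_map_embedding N) ij.
have jE : incl_map N \o j = incl_map I by apply/funext.
have JI z : mJ (incl_map I) z = mJ j z *m mJ (incl_map N) (j z).
  by rewrite -jE (smooth_map_comp sj sN).2.
have [sg Jg] := smooth_map_comp sj sp; set g := proj \o j in sg Jg.
have rg : range g = proj @` (incl_map N @^-1` range (incl_map L)).
  apply/seteqP; split=> [_ [z _ <-]|_ [x [y _ xy] <-]].
    by exists (j z) => //; exists (jL z) => //; rewrite ijL ij.
  have : range (incl_map I) (incl_map N x).
    by rewrite rI; split; [exists x|exists y].
  move=> [z _ zx]; exists z => //; rewrite /g /=; congr proj; apply: injN.
  by rewrite ij.
have dpull := pullback_dform sN sp heta.1 hetat.1 hpull.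
(* Cleanness enters here: the image of the tangent space of [I] under the projection is the reduced
   subspace of [reduction_legendrian]. Injectivity of the differential of N lets vectors be compared
   inside N. *)
have tgE z : tangent g z = [set v | exists2 u : 'rV[R]_d,
    tangent (incl_map L) (jL z) (u *m mJ (incl_map N) (j z)) & v = u *m mJ proj (j z)].
  have := tI z (j z) (jL z) (ij z) (ijL z); rewrite [tangent g z]tangentE Jg => E.
  apply/seteqP; split=> [_ [w _ <-]|v [u Lu ->]].
    exists (w *m mJ j z); last by rewrite mulmxA.
    have : tangent (incl_map I) z (w *m mJ j z *m mJ (incl_map N) (j z)).
      by rewrite tangentE; exists w; rewrite // -mulmxA -JI.
    by rewrite E => -[].
  have : tangent (incl_map I) z (u *m mJ (incl_map N) (j z)).
    by rewrite E; split=> //; rewrite tangentE; exists u.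
  rewrite tangentE JI => -[w _]; rewrite mulmxA.
  have /row_free_inj := (injective_mdiffP _ (j z)).1 (iN (j z)).
  by move=> inj /inj <-; exists w => //; rewrite mulmxA.
have legg : legendrian etat g.
  move=> z; rewrite tgE [tangent _ (jL z)]tangentE.
  apply: (reduction_legendrian (eta := eta) (x := incl_map N (j z))) => //.
  - by move=> u; have := hpull (j z) u; rewrite !mdiffE.
  - exact: dpull.
  - move=> v; have : range (mdiff proj (j z)) v by rewrite psurj.
    by move=> [u _ <-]; exists u; rewrite mdiffE.
  - by have := hN (j z); rewrite tangentE.
  - apply: contrapT => h; apply: (hNhor (j z)); rewrite /horizontal tangentE.
    move=> _ [u _ <-] /=; apply/eqP; apply: contrapT => u0; apply: h; exists u.
    exact/negP.
  - move=> u Cu; apply: (characteristic_ker hproj); rewrite /characteristic /= mdiffE tangentE.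
    exact: Cu.
  - by rewrite ij -(ijL z); have := hL (jL z); rewrite tangentE.
(* Constancy of the rank comes from the Legendrian condition at each point, without any comparison
   between points. *)
have rkg z : \rank (mJ g z) = k.
  by apply: (legendrian_rank hetat); rewrite -[RHS]tangentE -tangentE; exact: legg.
have [q [S [f [imf rf tf]]]] := constant_rank_image sg rkg.
have legf : legendrian etat f.
  by move=> w; have [z -> ->] := tf w; exact: legg.
split; first by exists q, S, f; split=> //; rewrite rf rg.
move=> q' Q rQ; apply: legendrian_embedded imf legf (incl_map_embedding Q) _.
by rewrite rQ rf rg.
Qed.
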